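(* Let $G=(X,Y)$ be a bipartite graph with fixed vertex bipartition $(X,Y)$ and $3 \le |X| \le 7$. If $G$ satisfies the super-neighborhood property, then $G$ contains a cycle $C$ with $X \subseteq V(C)$.
   Context: All graphs are finite and simple. For a vertex set $S$ of a graph $G$ and an integer $i$, $\Lambda^i(S)$ denotes the set of vertices of $G$ adjacent to at least $i$ vertices of $S$; $G[A]$ is the subgraph induced by $A$. A bipartite graph $G=(X,Y)$ with $|X|\ge 3$ satisfies the super-neighborhood property if for every $S\subseteq X$ with $|S|\ge 3$ we have $|\Lambda^2(S)|\ge |S|$ and $G[S\cup \Lambda^2(S)]$ is $2$-connected. *)

(* Defs.v *)
From mathcomp Require Import all_boot.

Set Implicit Arguments.
Unset Strict Implicit.
Unset Printing Implicit Defensive.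

(* A finite simple graph is a symmetric irreflexive relation e on a finType;   *)
(* subgraphs induced by A : {set T} are kept on the carrier T.                 *)

Definition simple_graph (T : finType) (e : rel T) : Prop :=
  symmetric e /\ irreflexive e.

Definition bipartition (T : finType) (e : rel T) (X Y : {set T}) : Prop :=
  [/\ X :|: Y = [set: T], [disjoint X & Y] &
      forall u v : T, e u v ->
        (u \in X) && (v \in Y) || (u \in Y) && (v \in X)].

Definition induced (T : finType) (e : rel T) (A : {set T}) : rel T :=
  [rel u v | [&& u \in A, v \in A & e u v]].

(* "G[A] is connected"; connect is reflexive on all of T, but only vertices of *)
(* A are compared.                                                             *)
Definition connected_on (T : finType) (e : rel T) (A : {set T}) : Prop :=
  {in A &, forall u v : T, connect (induced e A) u v}.

(* "G[A] is k-connected": more than k vertices, and still connected after the  *)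
(* deletion of any fewer than k vertices.                                      *)
Definition k_connected_on (k : nat) (T : finType) (e : rel T) (A : {set T})
    : Prop :=
  k < #|A| /\
  forall Z : {set T}, Z \subset A -> #|Z| < k -> connected_on e (A :\: Z).

Definition Lambda (T : finType) (e : rel T) (i : nat) (S : {set T}) : {set T} :=
  [set v : T | i <= #|[set u in S | e v u]|].

Definition super_neighborhood (T : finType) (e : rel T) (X : {set T}) : Prop :=
  forall S : {set T}, S \subset X -> 3 <= #|S| ->
    #|S| <= #|Lambda e 2 S| /\ k_connected_on 2 e (S :|: Lambda e 2 S).

(* ucycle alone would allow a single edge traversed back and forth.            *)
Definition graph_cycle (T : finType) (e : rel T) (c : seq T) : Prop :=
  3 <= size c /\ ucycle e c.

(* Main.v *)
Require Import Defs.
From mathcomp Require Import all_boot.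

Set Implicit Arguments.
Unset Strict Implicit.
Unset Printing Implicit Defensive.

(** Regard every vertex [y] as the hyperedge [N(y)] on [X]; the goal is a Berge
    cycle through all of [X].  The super-neighborhood property yields three lower
    bounds on numbers of hyperedges: every pair of [X] lies in a hyperedge, every
    cherry [ab, ac] is met by at least two (both from the 2-connectivity for
    triples), and every [S] with [3 <= #|S|] has at least [#|S|] hyperedges that
    contain two of its elements.  By induction on [#|X|] there is a Berge cycle
    [v_1 y_1 v_2 y_2 ... v_n y_n] through [X] minus one vertex [x].  Let [J] be
    the set of the indices [i] with [y_i] adjacent to [x].  The sets [J] are
    excluded one dihedral class after the other, roughly from the largest to the
    smallest; excluding a class provides a forbidden configuration that, like the
    Berge cycle through [X] itself, prunes the later case analyses.  These case
    analyses were found by a computer search, are recorded as explicit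
    refutation trees, and are replayed by a verified checker. *)

(** The lower bounds concern only subsets of [X], and the supply of hyperedges is never reduced;
    hence they pass to every subset of [X], which is what the induction needs. A cycle pattern
    records only incidences that are present. Excluding [J] therefore excludes every set containing
    [J] and, since rows and columns may be renamed, every rotation and reflection. Each tree may
    thus assume that [x] avoids the rows that would enlarge [J] to an excluded class. Renaming also
    changes the missed vertex: if [x] lies on both [y_(i-1)] and [y_i], it can be exchanged with
    [v_i], and the earlier exclusions then constrain [v_i]. The two extremes are easy. If [x] lies
    on all [y_i], one further hyperedge through any pair closes a full cycle. If [x] lies on at most
    one [y_i], cherries at [x] supply what is needed to insert [x] between two consecutive vertices
    of the cycle. Every dihedral class between these extremes gets its own tree, and the trees
    depend on the value of [#|X|]; this is where the bound 7 enters. *)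

(** * Partial incidence matrices and cycle patterns *)

(* Partial information on an incidence matrix: rows are hyperedges, columns are
   vertices of [X], and [None] is an undetermined incidence. *)
Definition pmatrix := seq (seq (option bool)).

Definition entry (M : pmatrix) (y x : nat) : option bool :=
  nth None (nth [::] M y) x.

Definition set_entry (M : pmatrix) (y x : nat) (b : bool) : pmatrix :=
  set_nth [::] M y (set_nth None (nth [::] M y) x (Some b)).

(* The Berge cycle on columns [0, ..., n-1] out of [k]; when [n = k.-1], the
   remaining column [n] is incident with the rows in [J]. *)
Definition cycle_pattern (k n : nat) (J : seq nat) : pmatrix :=
  [seq [seq if [|| j == i, j == i.+1 %% n | (j == n) && (i \in J)]
            then Some true else None | j <- iota 0 k] | i <- iota 0 n].

(* Index sequences are written as decimal literals: the digits [1] to [9] stand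
   for the indices [0] to [8], and the literal [0] for the empty sequence. *)
Fixpoint digits (d : Decimal.uint) : seq nat :=
  match d with
  | Decimal.Nil => [::]
  | Decimal.D0 d => digits d
  | Decimal.D1 d => 0 :: digits d
  | Decimal.D2 d => 1 :: digits d
  | Decimal.D3 d => 2 :: digits d
  | Decimal.D4 d => 3 :: digits d
  | Decimal.D5 d => 4 :: digits d
  | Decimal.D6 d => 5 :: digits d
  | Decimal.D7 d => 6 :: digits d
  | Decimal.D8 d => 7 :: digits d
  | Decimal.D9 d => 8 :: digits d
  end.

Definition digits_of_number (n : Number.uint) : option Decimal.uint :=
  if n is Number.UIntDecimal d then Some d else None.

Declare Scope digits_scope.
Delimit Scope digits_scope with digits.
Number Notation Decimal.uint digits_of_number Number.UIntDecimal : digits_scope.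
Bind Scope digits_scope with Decimal.uint.

(** * Refutation trees and their checker *)

(* [Emb i vs us]: the [i]-th forbidden pattern occurs, its columns being mapped
     to [vs] and its rows to [us].
   [Split x y r1 r2]: [y] is adjacent to [x] in [r1] and not adjacent in [r2].
   [Cover c B K rs]: more than [#|K|] hyperedges contain one of the pairs of
     [demand c B], hence one outside [K] does; [rs] treats the possible rows and
     pairs, and then a new row.  [c = 0] demands the pairs inside [B], otherwise
     the pairs joining column [c.-1] to [B].
   As in the literals, the numbers [x], [y] and [c] count columns and rows from 1. *)
Inductive refutation : Type :=
| Emb (i : nat) (vs us : Decimal.uint)
| Split (x y : nat) (r1 r2 : refutation)
| Cover (c : nat) (B K : Decimal.uint) (rs : seq refutation).

Fixpoint pairs (s : seq nat) : seq (nat * nat) :=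
  if s is a :: s' then [seq (a, b) | b <- s'] ++ pairs s' else [::].

Definition demand (c : nat) (B : seq nat) : seq (nat * nat) :=
  if c is a.+1 then [seq (a, b) | b <- B] else pairs B.

(** These conditions make [size B] the guaranteed number of hyperedges in all three cases: the size
    of a set of at least three vertices, 1 for a pair, 2 for a cherry. A single comparison with
    [size K] then serves every [Cover]. *)
Definition demand_ok (k c : nat) (B : seq nat) : bool :=
  [&& uniq B, all (gtn k) B &
   if c is a.+1 then [&& 0 < size B, size B <= 2, a < k & a \notin B]
   else 3 <= size B].

Definition blocked (M : pmatrix) (y : nat) (p : nat * nat) : bool :=
  (entry M y p.1 == Some false) || (entry M y p.2 == Some false).

(** The order is part of the certificate format, because [check] matches [rs] against it position by
    position. Index [size M] stands for a hyperedge not yet named, on which every demanded pair is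
    possible. *)
Definition options (M : pmatrix) (F : seq (nat * nat)) (K : seq nat)
    : seq (nat * (nat * nat)) :=
  [seq (y, p) | y <- [seq y <- iota 0 (size M) | y \notin K],
                p <- [seq p <- F | ~~ blocked M y p]]
  ++ [seq (size M, p) | p <- F].

Definition fill (M : pmatrix) (o : nat * (nat * nat)) : pmatrix :=
  set_entry (set_entry M o.1 o.2.1 true) o.1 o.2.2 true.

(** Columns are permuted, because a pattern speaks of all of [X]; rows are only chosen injectively,
    so [M] may have more of them. This renaming covers the dihedral symmetries of the cycle and lets
    another vertex play the missed one. *)
Definition embeds (k : nat) (P : pmatrix) (vs us : seq nat) (M : pmatrix)
    : bool :=
  [&& size vs == k, uniq vs, all (gtn k) vs,
      size us == size P, uniq us, all (gtn (size M)) us &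
   all (fun i => all (fun j => if entry P i j is Some b
                     then entry M (nth 0 us i) (nth 0 vs j) == Some b else true)
                  (iota 0 k)) (iota 0 (size P))].

Fixpoint check (k : nat) (env : seq pmatrix) (r : refutation) (M : pmatrix)
    : bool :=
  match r with
  | Emb i vs us =>
      (i < size env) && embeds k (nth [::] env i) (digits vs) (digits us) M
  | Split x y r1 r2 =>
      [&& y.-1 < size M, check k env r1 (set_entry M y.-1 x.-1 true)
        & check k env r2 (set_entry M y.-1 x.-1 false)]
  | Cover c B K rs =>
      [&& demand_ok k c (digits B), size (digits K) < size (digits B)
        & all2 (fun r o => check k env r (fill M o)) rs
            (options M (demand c (digits B)) (digits K))]
  end.

(** A pattern enters [env] only after its own tree is accepted, so an [Emb] cannot be circular. *)
Fixpoint check_chain (k : nat) (env : seq pmatrix)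
    (ls : seq (Decimal.uint * refutation)) : bool :=
  if ls is (J, r) :: ls' then
    let P := cycle_pattern k k.-1 (digits J) in
    check k env r P && check_chain k (rcons env P) ls'
  else true.

(** * Entries of matrices and the pairs of a demand *)

Lemma entry_set M y x b i j :
  entry (set_entry M y x b) i j =
  if (i == y) && (j == x) then Some b else entry M i j.
Proof.
rewrite /entry /set_entry nth_set_nth /=; case: eqVneq => [->|//] /=.
by rewrite nth_set_nth /=; case: eqVneq.
Qed.

Lemma entry_default M y x : size M <= y -> entry M y x = None.
Proof. by move=> le_y; rewrite /entry (nth_default _ le_y) nth_nil. Qed.

Lemma size_set_entry M y x b : y < size M -> size (set_entry M y x b) = size M.
Proof. by move=> lt_y; rewrite size_set_nth; apply/maxn_idPr. Qed.

Lemma mem_pairs a b s : (a, b) \in pairs s -> (a \in s) && (b \in s).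
Proof.
elim: s => //= c s IHs; rewrite mem_cat => /orP[/mapP[d ds [-> ->]]|/IHs/andP[as_ bs]].
  by rewrite mem_head inE ds orbT.
by rewrite !inE as_ bs !orbT.
Qed.

Lemma has_pairs (P : pred nat) s :
  2 <= count P s -> has (fun p => P p.1 && P p.2) (pairs s).
Proof.
elim: s => //= a s IHs; rewrite has_cat has_map; case Pa: (P a) => /=.
  rewrite add1n ltnS -has_count => hs; apply/orP; left.
  by apply: sub_has hs => b Pb /=; rewrite Pa.
by rewrite add0n => /IHs ->; rewrite orbT.
Qed.

Lemma demand_lt k c B p : demand_ok k c B -> p \in demand c B ->
  (p.1 < k) && (p.2 < k).
Proof.
case/and3P=> _ /allP ltB; case: c => [_|a /and4P[_ _ lta _]] /=.
  by case: p => a b /mem_pairs/andP[/ltB/= -> /ltB].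
by case/mapP=> b /ltB ltb -> /=; rewrite lta.
Qed.

(** * Soundness of the checker *)

Section Soundness.

(* Refuting a pattern means deriving [G], which will be the existence of a
   Hamiltonian Berge cycle; this keeps the argument constructive. *)
Variables (T : finType) (e : rel T) (X : {set T}) (x0 : T) (G : Prop).

(** The members of [ys] may be arbitrary vertices; for the full cycle, [sat_cycle] derives from the
    bipartition that they lie outside [X]. Columns from [#|X|] on are ignored, in agreement with
    [embeds], which compares only the first [k] columns. *)
Definition sat (M : pmatrix) (xs ys : seq T) : Prop :=
  [/\ uniq xs, xs =i X, uniq ys, size ys = size M &
      forall y x b, x < #|X| -> entry M y x = Some b ->
        e (nth x0 ys y) (nth x0 xs x) = b].

Definition refuted (M : pmatrix) : Prop := forall xs ys, sat M xs ys -> G.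

Lemma size_sat M xs ys : sat M xs ys -> size xs = #|X|.
Proof. by case=> Uxs Exs _ _ _; rewrite -(card_uniqP Uxs); apply: eq_card. Qed.

(** Writing the true value keeps the matrix satisfied. Branching on that value justifies [Split];
    knowing it to be [true] justifies filling a known row in [Cover]. *)
Lemma sat_set M xs ys y x :
  y < size M -> sat M xs ys ->
  sat (set_entry M y x (e (nth x0 ys y) (nth x0 xs x))) xs ys.
Proof.
move=> lt_y [Uxs Exs Uys sz_ys HM]; split=> // [|i j b lt_j].
  by rewrite size_set_entry.
by rewrite entry_set; case: ifP => [/andP[/eqP-> /eqP->] [<-]|_ /HM->].
Qed.

Lemma sat_fill M xs ys y p :
  y < size M -> sat M xs ys ->
  e (nth x0 ys y) (nth x0 xs p.1) -> e (nth x0 ys y) (nth x0 xs p.2) ->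
  sat (fill M (y, p)) xs ys.
Proof.
move=> lt_y sM e1 e2; rewrite /fill /=.
have := @sat_set _ _ _ _ p.1 lt_y sM; rewrite e1 => s1.
have lt_y' : y < size (set_entry M y p.1 true) by rewrite size_set_entry.
by have := @sat_set _ _ _ _ p.2 lt_y' s1; rewrite e2.
Qed.

Lemma sat_fill_new M xs ys z p :
  z \notin ys -> p.1 < #|X| -> p.2 < #|X| -> sat M xs ys ->
  e z (nth x0 xs p.1) -> e z (nth x0 xs p.2) ->
  sat (fill M (size M, p)) xs (rcons ys z).
Proof.
move=> z_ys lt1 lt2 [Uxs Exs Uys sz_ys HM] e1 e2; split=> //.
- by rewrite rcons_uniq z_ys.
- rewrite /fill /set_entry /= !size_set_nth size_rcons sz_ys.
  by rewrite (maxn_idPl (leqnSn _)) maxnn.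
move=> y x b lt_x; rewrite /fill /= !entry_set nth_rcons sz_ys.
case: (ltngtP y (size M)) => [lt_y|gt_y|->] /=.
- exact: HM.
- by rewrite entry_default // ltnW.
case: eqP => [-> [<-] //|_]; case: eqP => [-> [<-] //|_].
by rewrite entry_default.
Qed.

(** Reading [xs] and [ys] through [vs] and [us] turns a realization of [M] into one of [P]. *)
Lemma refuted_embeds P M vs us :
  refuted P -> embeds #|X| P vs us M -> refuted M.
Proof.
move=> rP /and5P[/eqP sz_vs Uvs /allP lt_vs /eqP sz_us].
case/and3P=> Uus /allP lt_us /allP HP xs ys sM.
have sz_xs := size_sat sM.
have [Uxs Exs Uys sz_ys HM] := sM.
have Umap (s : seq T) l : uniq s -> uniq l -> {in l, forall i, i < size s} ->
    uniq [seq nth x0 s i | i <- l].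
  move=> Us Ul lt_l; rewrite map_inj_in_uniq // => i j /lt_l lti /lt_l ltj /eqP.
  by rewrite nth_uniq // => /eqP.
have Uvx : uniq [seq nth x0 xs i | i <- vs].
  by apply: Umap => // i /lt_vs; rewrite sz_xs.
apply: (rP [seq nth x0 xs i | i <- vs] [seq nth x0 ys i | i <- us]); split=> //.
- have sub : {subset [seq nth x0 xs i | i <- vs] <= xs}.
    by move=> _ /mapP[i /lt_vs lti ->]; rewrite mem_nth // sz_xs.
  (* The selected columns are distinct and as many as [xs], so they exhaust [X]. *)
  have [|_ E] := uniq_min_size Uvx sub; first by rewrite size_map sz_vs sz_xs.
  by move=> z; rewrite E Exs.
- by apply: Umap => // i /lt_us; rewrite sz_ys.
- by rewrite size_map.
move=> i j b lt_j Pij.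
have lt_i : i < size P.
  by rewrite ltnNge; apply/negP=> le_i; rewrite entry_default in Pij.
have /allP/(_ j) := HP i (etrans (mem_iota 0 _ _) lt_i).
rewrite mem_iota Pij => /(_ lt_j)/eqP/HM E.
rewrite !(nth_map 0) ?sz_us ?sz_vs // E //.
by apply: lt_vs; rewrite mem_nth // sz_vs.
Qed.

Hypothesis pair_demand : forall a b, a \in X -> b \in X -> a != b ->
  exists y, e y a && e y b.
Hypothesis cherry_demand : forall a b c, a \in X -> b \in X -> c \in X ->
  a != b -> a != c -> b != c -> 2 <= #|[set y | e y a && (e y b || e y c)]|.
Hypothesis clique_demand : forall S : {set T}, S \subset X -> 3 <= #|S| ->
  #|S| <= #|Lambda e 2 S|.

(** This translates the three hypotheses from vertices to column indices: [c = 0] uses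
    [clique_demand] on the vertices named by [B]; otherwise a one-element [B] uses [pair_demand] and
    a two-element [B] uses [cherry_demand]. *)
Lemma demandP c B xs : uniq xs -> xs =i X -> demand_ok #|X| c B ->
  size B <= #|[set y | has (fun p => e y (nth x0 xs p.1) && e y (nth x0 xs p.2))
                       (demand c B)]|.
Proof.
move=> Uxs Exs /and3P[UB /allP ltB]; set v := nth x0 xs.
have sz_xs : size xs = #|X| by rewrite -(card_uniqP Uxs); apply: eq_card.
have Xv i : i < #|X| -> v i \in X by move=> lt_i; rewrite -Exs mem_nth ?sz_xs.
have vX i j : i < #|X| -> j < #|X| -> i != j -> v i != v j.
  by move=> lt_i lt_j; rewrite nth_uniq ?sz_xs.
case: c => [|a] /=.
- move=> szB; set S := [set x in [seq v i | i <- B]].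
  have Uv : uniq [seq v i | i <- B].
    rewrite map_inj_in_uniq // => i j /ltB lti /ltB ltj /eqP.
    by rewrite nth_uniq ?sz_xs // => /eqP.
  have cS : #|S| = size B by rewrite cardsE (card_uniqP Uv) size_map.
  rewrite -cS; apply: leq_trans (clique_demand _ _) _; rewrite ?cS //.
    by apply/subsetP=> x; rewrite inE => /mapP[i /ltB lti ->]; apply: Xv.
  (* Two neighbours of [y] in [S] come from two positions of [B], and these form one of the demanded
     pairs. *)
  apply/subset_leq_card/subsetP=> y; rewrite !inE => le2.
  apply: (@has_pairs (fun i => e y (v i))); rewrite -(count_map v) -size_filter.
  rewrite -(card_uniqP (filter_uniq _ Uv)); apply: leq_trans le2 _.
  by apply/subset_leq_card/subsetP=> z; rewrite !inE mem_filter andbC.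
case/and4P=> B0 B2 lta aB.
case: B UB ltB B0 B2 aB => [|b [|c []]] //= UB ltB _ _.
- rewrite inE => ab; have ltb : b < #|X| by apply: ltB; rewrite mem_head.
  have [y yab] := pair_demand (Xv _ lta) (Xv _ ltb) (vX _ _ lta ltb ab).
  by apply/card_gt0P; exists y; rewrite inE /= orbF.
rewrite !inE negb_or => /andP[ab ac].
have ltb : b < #|X| by apply: ltB; rewrite mem_head.
have ltc : c < #|X| by apply: ltB; rewrite !inE eqxx orbT.
move: UB; rewrite inE andbT => bc.
apply: leq_trans (cherry_demand (Xv _ lta) (Xv _ ltb) (Xv _ ltc) _ _ _) _;
  rewrite ?vX //.
apply/subset_leq_card/subsetP=> y; rewrite !inE /= orbF.
by case/andP=> -> /orP[->|->]; rewrite ?orbT.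
Qed.

Lemma check_sound env :
  {in env, forall P, refuted P} ->
  forall r M, check #|X| env r M -> refuted M.
Proof.
(* The type [refutation] recurs through [seq refutation]; the explicit fixpoint makes the hypothesis
   available for the members of [rs]. *)
move=> rE; fix IH 1 => -[i vs us|x y r1 r2|c B K rs] M /=.
- by case/andP=> lt_i; apply: refuted_embeds; apply: rE; rewrite mem_nth.
- case/and3P=> lt_y /IH r1M /IH r2M xs ys /(sat_set x.-1 lt_y).
  by case: (e _ _) => [/r1M|/r2M].
case/and3P=> okB ltK chk.
have {chk} : {in options M (demand c (digits B)) (digits K),
    forall o, refuted (fill M o)}.
  elim: rs (options _ _ _) chk => [|r rs IHrs] [|o os] //= /andP[/IH ro /IHrs ros].
  by move=> o'; rewrite inE => /predU1P[->//|/ros].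
move: (digits B) (digits K) okB ltK => {}B {}K {rs} okB ltK rO xs ys sM.
have [Uxs Exs Uys sz_ys HM] := sM.
have := demandP Uxs Exs okB; set V := [set y | _] => leV.
(* Pigeonhole: at least [size B] hyperedges meet the demand, and [K] names at most [size K < size B]
   of them. *)
have /subsetPn[z] : ~~ (V \subset [seq nth x0 ys i | i <- K]).
  apply/negP=> /subset_leq_card leVK; move: ltK; rewrite ltnNge => /negP[].
  by apply: leq_trans leV (leq_trans leVK _); rewrite -(size_map (nth x0 ys)) card_size.
rewrite inE => /hasP[p pF /andP[e1 e2]] zK.
have /andP[lt1 lt2] := demand_lt okB pF.
(* The extra hyperedge [z] is either unnamed, and is appended as a new row, or already a row of [M],
   whose index is then outside [K]. *)
case: (boolP (z \in ys)) => [z_ys|z_ys]; last first.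
  apply: (rO (size M, p)) (sat_fill_new z_ys lt1 lt2 sM e1 e2).
  by rewrite mem_cat map_f ?orbT.
have lt_z : index z ys < size M by rewrite -sz_ys index_mem.
have Ez : nth x0 ys (index z ys) = z by rewrite nth_index.
apply: (rO (index z ys, p)) (sat_fill lt_z sM _ _); rewrite ?Ez //.
rewrite mem_cat; apply/orP; left; apply/allpairsPdep; exists (index z ys), p; split=> //.
  rewrite mem_filter mem_iota /= add0n lt_z andbT; apply: contra zK => zK.
  by apply/mapP; exists (index z ys).
(* Since [z] contains both vertices of the pair, neither entry can be recorded as absent, so this
   option was not filtered out. *)
rewrite mem_filter pF andbT; apply/norP; split; apply/eqP=> /HM; rewrite Ez.
  by rewrite e1 => /(_ lt1).
by rewrite e2 => /(_ lt2).
Qed.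

Lemma check_chain_sound ls env :
  {in env, forall P, refuted P} -> check_chain #|X| env ls ->
  {in [seq digits l.1 | l <- ls],
    forall J, refuted (cycle_pattern #|X| #|X|.-1 J)}.
Proof.
elim: ls env => //= -[J r] ls IHls env rE /andP[/(check_sound rE) rJ chk] J'.
rewrite inE => /predU1P[->//|]; apply: IHls chk _ => P.
by rewrite mem_rcons inE => /predU1P[->//|/rE].
Qed.

End Soundness.

Lemma entry_cycle_pattern k n J i j :
  entry (cycle_pattern k n J) i j =
  if [&& i < n, j < k & [|| j == i, j == i.+1 %% n | (j == n) && (i \in J)]]
  then Some true else None.
Proof.
case: (ltnP i n) => [lt_i|le_i] /=; last by rewrite entry_default // size_map size_iota.
rewrite /entry (nth_map 0) ?size_iota // nth_iota // add0n.
case: (ltnP j k) => [lt_j|le_j] /=; last by rewrite nth_default // size_map size_iota.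
by rewrite (nth_map 0) ?size_iota // nth_iota.
Qed.

Lemma size_cycle_pattern k n J : size (cycle_pattern k n J) = n.
Proof. by rewrite size_map size_iota. Qed.

(** * From 2-connectivity to hyperedges, and from Berge cycles to cycles *)

Section Graph.

Variables (T : finType) (e : rel T) (Y : {set T}).
Hypothesis sym_e : symmetric e.

(** Follow a path inside [A] from [a] to [b] up to its first step out of [R]. *)
Lemma connected_on_crossing (A R : {set T}) a b :
  connected_on e A -> a \in A -> b \in A -> a \in R -> b \notin R ->
  exists u v, [/\ u \in A :&: R, v \in A :\: R & e u v].
Proof.
move=> conA aA bA; have /connectP[p] := conA a b aA bA.
elim: p a {aA} => [|c p IHp] a /=; first by move=> _ -> ->.
case/andP=> /and3P[aA cA eac] pth lst aR bR.
case: (boolP (c \in R)) => cR; first exact: IHp pth lst cR bR.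
by exists a, c; rewrite !inE aA aR cA cR.
Qed.

Section Triple.

Variables (X : {set T}) (a b c : T).
Hypotheses (bipX : bipartition e X Y) (superX : super_neighborhood e X).
Hypotheses (aX : a \in X) (bX : b \in X) (cX : c \in X).
Hypotheses (ab : a != b) (ac : a != c) (bc : b != c).

Lemma notin_side u v : e u v -> v \in X -> u \notin X.
Proof.
have [_ dXY] := bipX => /[apply] /orP[]/andP[uX vY] vX; last first.
  by rewrite (disjointFl dXY).
by move: vX; rewrite (disjointFl dXY vY).
Qed.

Let S := [set a; b; c].
Let A := S :|: Lambda e 2 S.

Lemma triple_connected (Z : {set T}) : Z \subset A -> #|Z| < 2 -> connected_on e (A :\: Z).
Proof.
have cS : #|S| = 3 by rewrite /S setUC cardsU1 cards2 !inE negb_or ab eq_sym ac eq_sym bc.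
have SX : S \subset X by rewrite /S !subUset !sub1set aX bX cX.
by have [|_ [_]] := superX SX _; [rewrite cS | apply].
Qed.

(** After deleting [c], the only vertices of [X] left in the induced graph are [a] and [b]. A path
    between them must leave [a] together with its neighbours, and it can do so only along an edge
    from a neighbour of [a] to [b]. *)
Lemma super_pair : exists y, e y a && e y b.
Proof.
have sub : [set c] \subset A by rewrite sub1set !inE eqxx !orbT.
have := triple_connected sub; rewrite cards1 => /(_ isT) con.
(* With [R] the closed neighbourhood of [a], a crossing edge starts at a neighbour [u] of [a], since
   an edge at [a] itself stays in [R]. *)
pose R := a |: [set y | e y a].
have [||||u [v []]] := @connected_on_crossing _ R a b con.
- by rewrite !inE eqxx ac.
- by rewrite !inE eqxx orbT bc.
- by rewrite !inE eqxx.
- rewrite !inE eq_sym (negPf ab) /=.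
  by apply/negP=> /notin_side/(_ aX); rewrite bX.
rewrite !inE => /andP[/andP[uc uA] uR] /andP[vR /andP[vc vA]] euv.
have [ua|uNa] := eqVneq u a.
  by case/negP: vR; rewrite -ua sym_e euv orbT.
move: uR; rewrite (negPf uNa) /= => eua; exists u; rewrite eua.
have uX := notin_side eua aX.
move: vR; rewrite negb_or => /andP[va _].
case/orP: vA => [|vL]; first by rewrite (negPf va) (negPf vc) orbF /= => /eqP <-.
(* If [v] were in [Lambda e 2 S], it would have a neighbour in [X] and so lie outside [X], as does
   [u]; the edge [u v] would violate the bipartition. *)
have /card_gt0P[w] : 0 < #|[set w in S | e v w]| by apply: leq_trans vL.
rewrite !inE => /andP[wS evw].
have wX : w \in X by case/orP: wS => [/orP[]|] /eqP->.
have vX := notin_side evw wX.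
have [_ _ /(_ u v euv)] := bipX.
by rewrite (negPf uX) (negPf vX) andbF.
Qed.

(** If [W] had at most one element, deleting it would leave [a] connected to [b]. But every
    neighbour of [a] in [Lambda e 2 S] also sees [b] or [c], hence lies in [W], so [a] would be
    isolated. *)
Lemma super_cherry : 2 <= #|[set y | e y a && (e y b || e y c)]|.
Proof.
set W := [set y | _]; rewrite leqNgt; apply/negP=> ltW.
have WL : {subset W <= Lambda e 2 S}.
  move=> y; rewrite !inE => /andP[ya ybc].
  have [z [za zS yz]] : exists z, [/\ z != a, z \in S & e y z].
    by case/orP: ybc => yz; [exists b | exists c]; rewrite eq_sym !inE eqxx ?orbT.
  have <- : #|[set a; z]| = 2 by rewrite cards2 eq_sym za.
  apply/subset_leq_card; rewrite subUset !sub1set 2!inE ya inE zS yz.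
  by rewrite !inE eqxx.
have sub : W \subset A by apply/subsetP=> y /WL yL; rewrite inE yL orbT.
have [||||u [v []]] := @connected_on_crossing _ [set a] a b (triple_connected sub ltW).
- by rewrite !inE eqxx andbT; apply: contraL aX => /andP[/notin_side->].
- rewrite !inE eqxx orbT andbT.
  by apply: contraL aX => /andP[]; rewrite sym_e => /notin_side->.
- by rewrite inE.
- by rewrite inE eq_sym.
rewrite !inE => /andP[_ /eqP->] /andP[va /andP[vW vA]] eav; case/negP: vW.
have eva : e v a by rewrite sym_e.
have vX := notin_side eva aX.
rewrite eva /=; case/orP: vA => [vS|].
  by case/negP: vX; case/orP: vS => [/orP[]|] /eqP->.
move=> vL; apply/negPn/negP=> /norP[/negPf vb /negPf vc].
move: vL; rewrite ltnNge => /negP[]; rewrite -(cards1 a).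
apply/subset_leq_card/subsetP=> w; rewrite !inE => /andP[/orP[/orP[]|] /eqP-> //].
  by rewrite vb.
by rewrite vc.
Qed.

End Triple.

(** Read alternately, the columns and rows of the full pattern form a cycle of length [2 * #|X|].
    The bipartition keeps the two kinds of vertices distinct. *)
Lemma sat_cycle X x0 xs ys : bipartition e X Y -> 3 <= #|X| ->
  sat e X x0 (cycle_pattern #|X| #|X| [::]) xs ys ->
  exists c, graph_cycle e c /\ {subset X <= c}.
Proof.
move=> bipX X3 sM; have sz_xs := size_sat sM.
have [Uxs Exs Uys] := sM; rewrite size_cycle_pattern => sz_ys HM.
set k := #|X| in X3 sz_xs sz_ys HM.
have k0 : 0 < k by apply: leq_trans X3.
have e1 i : i < k -> e (nth x0 ys i) (nth x0 xs i).
  by move=> lt_i; apply: HM => //; rewrite entry_cycle_pattern lt_i eqxx.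
have e2 i : i < k -> e (nth x0 ys i) (nth x0 xs (i.+1 %% k)).
  move=> lt_i; apply: HM; rewrite ?ltn_pmod // entry_cycle_pattern.
  by rewrite lt_i ltn_pmod // eqxx orbT.
have xX i : i < k -> nth x0 xs i \in X by move=> lt_i; rewrite -Exs mem_nth ?sz_xs.
have yX i : i < k -> nth x0 ys i \notin X.
  by move=> lt_i; apply: notin_side (e1 i lt_i) (xX i lt_i).
(* Even positions carry the vertices of [X], odd positions the hyperedges. *)
pose f i := if odd i then nth x0 ys i./2 else nth x0 xs i./2.
have lt_half i : i < k.*2 -> i./2 < k by rewrite ltn_half_double.
exists (mkseq f k.*2); split; last first.
  move=> x; rewrite -Exs => /(nthP x0)[i]; rewrite sz_xs => lt_i <-.
  apply/mapP; exists i.*2; first by rewrite mem_iota ltn_double.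
  by rewrite /f odd_double doubleK.
split; first by rewrite size_mkseq -addnn (leq_trans X3) ?leq_addr.
apply/andP; split; last first.
  apply/mkseq_uniqP=> i j; rewrite !inE => /lt_half lti /lt_half ltj; rewrite /f.
  move=> E; rewrite -(odd_double_half i) -(odd_double_half j); move: E.
  case: (odd i) (odd j) => [] [] /eqP.
  - by rewrite nth_uniq ?sz_ys // => /eqP->.
  - by move=> /eqP E; have := xX _ ltj; rewrite -E (negPf (yX _ lti)).
  - by move=> /eqP E; have := xX _ lti; rewrite E (negPf (yX _ ltj)).
  by rewrite nth_uniq ?sz_xs // => /eqP->.
(* Periodicity makes the closing edge an instance of the general step from [i] to [i.+1]. *)
pose g i := f (i %% k.*2).
have n0 : 0 < k.*2 by rewrite double_gt0.
have -> : mkseq f k.*2 = g 0 :: [seq g i | i <- iota 1 k.*2.-1].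
  rewrite -[k.*2 in LHS]prednK //= /g mod0n; congr (_ :: _).
  apply/eq_in_map=> i; rewrite mem_iota add1n prednK // => /andP[_ lt_i].
  by rewrite modn_small.
have gS i : i < k.*2 -> e (g i) (g i.+1).
  move=> lt_i; have lt_h := lt_half _ lt_i; rewrite /g (modn_small lt_i).
  have := odd_double_half i; move: (odd i) i./2 lt_h => odd_i m lt_m Ei.
  case: odd_i Ei lt_i => <- lt_i.
    (* Reducing [2(m+1)] modulo [2k] is doubling [m+1] modulo [k]; for the last row this leads back
       to column 0. *)
    rewrite add1n -[m.*2.+2]/(m.+1.*2) -!mul2n -muln_modr !mul2n /f /=.
    by rewrite !odd_double /= uphalf_double doubleK; apply: e2.
  rewrite add0n.
  rewrite modn_small ?ltn_Sdouble // /f /= !odd_double /= uphalf_double doubleK.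
  by rewrite sym_e e1.
rewrite /cycle.
rewrite /cycle.
rewrite /cycle.
rewrite /cycle.
have -> : rcons [seq g i | i <- iota 1 k.*2.-1] (g 0) = [seq g i | i <- iota 1 k.*2].
  have -> : iota 1 k.*2 = iota 1 k.*2.-1 ++ [:: k.*2].
    by rewrite -{1}(prednK n0) -[k.*2.-1.+1]addn1 iotaD /= add1n prednK.
  by rewrite map_cat cats1 /g modnn mod0n.
rewrite /= path_map; apply/(pathP 0) => i; rewrite size_iota => lt_i.
rewrite /= nth_iota // add1n; case: i lt_i => [|i] lt_i /=; first exact: gS.
by rewrite nth_iota ?(ltnW lt_i) // add1n; apply: gS.
Qed.

End Graph.

(** * The recorded refutations *)

Definition hamiltonian (T : finType) (e : rel T) (X : {set T}) : Prop :=
  exists x0 xs ys, sat e X x0 (cycle_pattern #|X| #|X| [::]) xs ys.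

(** There is no smaller Berge cycle to extend here, so the tree starts from the empty matrix. It
    takes a hyperedge through columns 2 and 3 and splits on whether it also contains column 1. *)
Definition refutation3 : refutation :=
Cover 2 3 0 [:: Split 1 1 (Cover 1 23 1 [:: Split 3 2 (Cover 0 123 12 [:: Emb 0 132 123; Emb 0 123
123; Emb 0 213 123]) (Cover 3 12 1 [:: Emb 0 123 213; Emb 0 213 213]); Split 2 2 (Cover 0 123 12 [::
Emb 0 132 123; Emb 0 123 123; Emb 0 213 123]) (Cover 2 13 1 [:: Emb 0 132 213; Emb 0 213 123])])
(Cover 1 3 0 [:: Split 2 2 (Cover 1 23 2 [:: Emb 0 132 213; Emb 0 123 213]) (Cover 1 2 0 [:: Emb 0
132 213])])].

(* Each entry of the lists below refutes the cycle pattern with the given [J],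
   using the full cycle (pattern 0) and the previous entries (patterns 1, 2, ...);
   the last entry has empty [J] and so refutes the cycle without conditions. *)
Definition refutations4 : seq (Decimal.uint * refutation) :=
(* Here [x] lies on every row of the cycle. The whole of [X] demands one hyperedge more than the
   cycle has, and whichever pair it contains, it closes a full cycle. The first entry for each
   larger size works in the same way. *)
[:: (123%digits, Cover 0 1234 123 [:: Emb 0 1432 1324; Emb 0 1243 1234; Emb 0 1234 1234; Emb 0 2143
1324; Emb 0 2134 1324; Emb 0 3214 2134]);
(* Since [x] lies on the two rows at column 2, these two vertices can be exchanged. If either lies
   on a further row of the cycle, an earlier class occurs. Otherwise the triple of columns 2, 3 and
   [x] demands a third hyperedge, which must be new. The entries for [12] at larger sizes repeat
   this. *)
(12%digits, Split 2 3 (Emb 1 1432 123) (Split 4 3 (Emb 1 1234 123) (Cover 0 234 12 [:: Emb 0 2413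
2134; Emb 0 2134 1324; Emb 0 3124 3124])));
(* Two rows containing [x] give an earlier class. If [x] lies on one row only, a cherry from [x] to
   the two cycle vertices of that row yields a new hyperedge that inserts [x] there. If on none, a
   first cherry gives a new hyperedge through [x] and some [v_i], and the cherry from [x] to the
   neighbours of [v_i] on the cycle gives a second; [x] then goes between two consecutive
   vertices. *)
(0%digits, Split 4 1 (Split 4 3 (Emb 2 3421 312) (Split 4 2 (Emb 2 3412 213) (Cover 4 12 1 [:: Emb 0
1324 3214; Emb 0 2314 2314]))) (Split 4 2 (Split 4 3 (Emb 2 1423 321) (Cover 4 23 2 [:: Emb 0 2134
1324; Emb 0 3124 3124])) (Split 4 3 (Cover 4 13 3 [:: Emb 0 1234 1234; Emb 0 3214 2134]) (Cover 4 13
1 [:: Cover 4 23 4 [:: Emb 0 2314 2345; Emb 0 3214 2145]; Cover 4 12 4 [:: Emb 0 1234 1245; Emb 0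
2134 1345]]))))].

Definition refutations5 : seq (Decimal.uint * refutation) :=
[:: (1234%digits, Cover 0 12345 1234 [:: Emb 0 15432 14325; Emb 0 12543 12435; Emb 0 12354 12345; Emb 0
12345 12345; Emb 0 21453 14325; Emb 0 21534 14235; Emb 0 21435 14325; Emb 0 32154 21435; Emb 0 32145
21435; Emb 0 43215 32145]);
(* Only row 4 misses [x]. The extra hyperedge closes a full cycle unless it joins columns 1 and 4,
   as row 4 does. In that case both rows avoid columns 2, 3 and 5, so the set of columns 2 to 5
   demands yet another hyperedge, which always closes one. The second entries for sizes 6 and 7
   follow the same scheme. *)
(123%digits, Split 5 4 (Emb 1 12345 1234) (Cover 0 12345 1234 [:: Emb 0 14352 43215; Emb 0 14523
43125; Split 5 5 (Emb 0 14325 43215) (Split 2 5 (Emb 0 14352 43215) (Split 3 5 (Emb 0 14523 43125)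
(Split 2 4 (Emb 0 14352 53214) (Split 3 4 (Emb 0 14523 53124) (Cover 0 2345 123 [:: Emb 0 21453
14326; Emb 0 23514 23146; Emb 0 21435 14326; Emb 0 35214 32146; Emb 0 32145 21436; Emb 0 41235
41236]))))); Emb 0 14325 43215; Emb 0 21453 14325; Emb 0 23514 23145; Emb 0 21435 14325; Emb 0 35214
32145; Emb 0 32145 21435; Emb 0 41235 41235]));
(12%digits, Split 2 3 (Emb 2 15342 1234) (Split 2 4 (Emb 2 35142 2143) (Split 5 3 (Emb 2 12345 1234)
(Split 5 4 (Emb 2 32145 2143) (Cover 0 235 12 [:: Emb 0 25143 21435; Emb 0 21435 14325; Emb 0 34125
34125])))));
(13%digits, Split 5 4 (Emb 3 45231 4123) (Split 5 2 (Emb 3 35142 2143) (Split 1 2 (Split 3 4 (Emb 2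
52341 1243) (Split 3 1 (Emb 3 13542 2134) (Split 2 4 (Split 4 2 (Emb 2 34251 2413) (Cover 3 45 3 [::
Emb 0 31254 24135; Emb 0 31245 21435])) (Cover 0 2345 123 [:: Emb 0 25413 13425; Emb 0 25314 13245;
Emb 0 23415 23415; Emb 0 35214 31245; Emb 0 32145 21435; Emb 0 41235 41235])))) (Split 3 4 (Split 1
3 (Emb 2 25431 1342) (Split 2 4 (Split 4 2 (Emb 3 52431 1423) (Cover 0 1345 134 [:: Emb 0 15423
13425; Emb 0 15324 13245; Emb 0 12345 12435; Emb 0 32154 24135; Emb 0 32145 21435; Emb 0 43215
32415])) (Cover 1 25 1 [:: Emb 0 15432 13425; Emb 0 12345 12435]))) (Cover 0 135 13 [:: Emb 0 14523
43125; Emb 0 14325 43215; Emb 0 32145 21435])))));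
(0%digits, Split 5 1 (Split 5 4 (Emb 3 45231 4123) (Split 5 2 (Emb 3 35142 2143) (Split 5 3 (Emb 4
12345 1234) (Cover 5 12 1 [:: Emb 0 14325 43215; Emb 0 23415 23415])))) (Split 5 2 (Split 5 3 (Emb 3
45213 3214) (Split 5 4 (Emb 4 14325 4321) (Cover 5 23 2 [:: Emb 0 21435 14325; Emb 0 34125 34125])))
(Split 5 3 (Split 5 4 (Emb 3 15324 4321) (Cover 5 34 3 [:: Emb 0 32145 21435; Emb 0 41235 41235]))
(Split 5 4 (Cover 5 14 4 [:: Emb 0 12345 12345; Emb 0 43215 32145]) (Cover 5 14 1 [:: Cover 5 24 5
[:: Emb 0 23415 23456; Emb 0 43215 32156]; Cover 5 13 5 [:: Emb 0 12345 12356; Emb 0 32145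
21456]])))))].

Definition refutations6 : seq (Decimal.uint * refutation) :=
[:: (12345%digits, Cover 0 123456 12345 [:: Emb 0 165432 154326; Emb 0 126543 125436; Emb 0 123654
123546; Emb 0 123465 123456; Emb 0 123456 123456; Emb 0 215463 154326; Emb 0 215634 154236; Emb 0
216345 152346; Emb 0 215436 154326; Emb 0 321564 215436; Emb 0 321645 215346; Emb 0 321546 215436;
Emb 0 432165 321546; Emb 0 432156 321546; Emb 0 543216 432156]);
(1234%digits, Split 6 5 (Emb 1 123456 12345) (Cover 0 123456 12345 [:: Emb 0 154362 543216; Emb 0
154623 543126; Emb 0 156234 541236; Split 6 6 (Emb 0 154326 543216) (Split 2 6 (Emb 0 154362 543216)
(Split 3 6 (Emb 0 154623 543126) (Split 4 6 (Emb 0 156234 541236) (Split 2 5 (Emb 0 154362 643215)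
(Split 3 5 (Emb 0 154623 643125) (Split 4 5 (Emb 0 156234 641235) (Cover 0 23456 1234 [:: Emb 0
215463 154327; Emb 0 215634 154237; Emb 0 234615 234157; Emb 0 215436 154327; Emb 0 321564 215437;
Emb 0 346215 342157; Emb 0 321546 215437; Emb 0 463215 432157; Emb 0 432156 321547; Emb 0 512346
512347]))))))); Emb 0 154326 543216; Emb 0 215463 154326; Emb 0 215634 154236; Emb 0 234615 234156;
Emb 0 215436 154326; Emb 0 321564 215436; Emb 0 346215 342156; Emb 0 321546 215436; Emb 0 463215
432156; Emb 0 432156 321546; Emb 0 512346 512346]));
(123%digits, Split 6 4 (Emb 2 123456 12345) (Split 6 5 (Emb 2 432156 32154) (Split 2 4 (Split 2 5
(Emb 2 361542 21543) (Cover 0 123456 12345 [:: Emb 0 154362 543216; Emb 0 154623 543126; Emb 0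
152634 541236; Split 4 6 (Emb 0 152634 541236) (Split 6 6 (Emb 0 154326 543216) (Split 2 6 (Emb 0
154362 543216) (Split 3 6 (Emb 0 154623 543126) (Split 4 5 (Emb 0 152634 641235) (Split 3 5 (Emb 0
154623 643125) (Cover 0 12346 1234 [:: Emb 0 154362 543217; Emb 0 154623 543127; Emb 0 152634
541237; Emb 0 154326 543217; Emb 0 215463 154327; Emb 0 236154 231547; Emb 0 215436 154327; Emb 0
325164 245137; Emb 0 321546 215437; Emb 0 432516 324517])))))); Emb 0 154326 543216; Emb 0 215463
154326; Emb 0 236154 231546; Emb 0 243615 432156; Emb 0 215436 154326; Emb 0 325164 245136; Emb 0
324615 243156; Emb 0 321546 215436; Emb 0 423615 423156; Emb 0 432516 324516; Emb 0 512436 514326]))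
(Split 2 5 (Cover 0 123456 12345 [:: Emb 0 163452 123456; Emb 0 125463 154326; Emb 0 163254 132546;
Emb 0 126345 512346; Emb 0 125436 154326; Emb 0 215463 154326; Emb 0 236154 231546; Emb 0 216345
512346; Emb 0 215436 154326; Emb 0 362154 321546; Emb 0 321645 251346; Emb 0 321546 215436; Split 1
6 (Emb 0 163254 132546) (Split 1 4 (Emb 0 163254 132564) (Split 2 6 (Emb 0 236154 231546) (Split 3 6
(Emb 0 321645 251346) (Split 3 4 (Emb 0 321645 251364) (Split 6 6 (Emb 0 451236 451236) (Cover 0
12346 1235 [:: Emb 0 163452 123457; Emb 0 125463 154327; Emb 0 163254 132547; Emb 0 125436 154327;
Emb 0 215463 154327; Emb 0 236154 231547; Emb 0 215436 154327; Emb 0 362154 321547; Emb 0 321546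
215437; Emb 0 451236 451237])))))); Emb 0 451236 451236; Emb 0 543216 432516]) (Split 1 4 (Split 3 4
(Split 3 5 (Emb 2 154623 54321) (Split 4 5 (Split 4 1 (Emb 2 215364 15432) (Split 4 2 (Emb 2 153624
54321) (Cover 4 26 3 [:: Emb 0 215364 154236; Emb 0 435126 345126]))) (Cover 0 12346 1234 [:: Emb 0
154362 543216; Emb 0 154623 543126; Emb 0 153264 542136; Emb 0 154326 543216; Emb 0 215463 154326;
Emb 0 215364 154236; Emb 0 215436 154326; Emb 0 362154 321546; Emb 0 321546 215436; Emb 0 435126
345126]))) (Split 3 5 (Split 1 3 (Emb 2 264531 13452) (Split 1 2 (Emb 2 623541 12543) (Cover 1 26 1
[:: Emb 0 164532 134526; Emb 0 123546 125436]))) (Cover 0 2356 123 [:: Emb 0 215463 154326; Emb 0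
263415 123456; Emb 0 215436 154326; Emb 0 326415 213456; Emb 0 321546 215436; Emb 0 514326
543216]))) (Split 3 5 (Split 3 4 (Emb 2 154623 54321) (Cover 0 12356 1235 [:: Emb 0 164532 134526;
Emb 0 126453 123456; Emb 0 132645 521346; Emb 0 123546 125436; Emb 0 215463 154326; Emb 0 213645
152346; Emb 0 215436 154326; Emb 0 312645 512346; Emb 0 321546 215436; Emb 0 543126 435126])) (Cover
0 1236 123 [:: Emb 0 154362 543216; Emb 0 154623 543126; Emb 0 154326 543216; Emb 0 215463 154326;
Emb 0 215436 154326; Emb 0 321546 215436])))))));
(124%digits, Split 2 3 (Emb 3 163452 12345) (Split 2 5 (Emb 3 361542 21543) (Split 6 3 (Emb 2 123456
12345) (Split 6 5 (Emb 2 321546 21543) (Split 1 3 (Split 4 5 (Emb 3 315624 35412) (Split 3 5 (Split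
5 1 (Emb 3 253461 15342) (Split 5 2 (Emb 3 251463 25341) (Split 5 3 (Emb 3 134625 53421) (Cover 5 46
4 [:: Emb 0 413265 352146; Emb 0 541326 435216])))) (Cover 0 23456 1234 [:: Emb 0 261543 215436; Emb
0 215634 154236; Emb 0 234615 234156; Emb 0 215436 154326; Emb 0 326514 214536; Emb 0 326415 214356;
Emb 0 345126 345126; Emb 0 462315 412356; Emb 0 432156 321546; Emb 0 512346 512346]))) (Split 4 5
(Split 1 4 (Emb 3 265431 14532) (Split 2 4 (Split 1 2 (Emb 3 561342 41235) (Cover 1 26 1 [:: Emb 0
163452 123546; Emb 0 123456 123546])) (Cover 0 126 12 [:: Emb 0 165432 145326; Emb 0 123456 123546;
Emb 0 215436 154326]))) (Cover 0 1246 124 [:: Emb 0 154362 543216; Emb 0 156234 541236; Emb 0 154326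
543216; Emb 0 215634 154236; Emb 0 215436 154326; Emb 0 432156 321546])))))));
(12%digits, Split 2 3 (Emb 3 163452 12345) (Split 2 4 (Emb 4 163452 12345) (Split 2 5 (Emb 3 361542
21543) (Split 6 3 (Emb 3 123456 12345) (Split 6 4 (Emb 4 123456 12345) (Split 6 5 (Emb 3 321546
21543) (Cover 0 236 12 [:: Emb 0 261543 215436; Emb 0 215436 154326; Emb 0 345126 345126])))))));
(13%digits, Split 6 5 (Emb 5 562341 51234) (Split 6 2 (Emb 5 361542 21543) (Split 6 4 (Emb 5 563214
43215) (Split 3 1 (Split 1 2 (Emb 5 136452 21345) (Split 3 5 (Split 1 3 (Emb 4 264531 13452) (Split
1 4 (Emb 4 453261 45213) (Split 2 5 (Split 4 2 (Emb 5 625431 15423) (Split 5 3 (Split 3 4 (Emb 5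
356124 43152) (Cover 0 1346 135 [:: Emb 0 164523 134526; Emb 0 163254 132546; Emb 0 123546 125436;
Emb 0 321654 251346; Emb 0 321546 215436; Emb 0 453216 432516])) (Cover 6 15 1 [:: Emb 0 123546
125436; Emb 0 543216 432516]))) (Cover 1 26 1 [:: Emb 0 164532 134526; Emb 0 123546 125436]))))
(Split 1 4 (Split 2 5 (Emb 4 254631 54312) (Split 3 4 (Split 4 5 (Emb 4 453261 54213) (Split 4 2
(Split 1 3 (Emb 5 436152 21354) (Split 5 3 (Emb 5 436512 21354) (Cover 6 15 1 [:: Emb 0 153246
541236; Emb 0 512346 512436]))) (Cover 0 1246 134 [:: Emb 0 154632 543126; Emb 0 153264 542136; Emb
0 154326 543216; Emb 0 236154 231546; Emb 0 231546 215436; Emb 0 451236 451236]))) (Cover 0 136 13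
[:: Emb 0 154623 543126; Emb 0 154326 543216; Emb 0 321546 215436]))) (Cover 0 136 13 [:: Emb 0
154623 543126; Emb 0 154326 543216; Emb 0 321546 215436])))) (Split 4 1 (Split 2 4 (Emb 4 361524
31542) (Split 4 2 (Split 2 5 (Emb 5 625431 15423) (Split 2 3 (Emb 3 163452 13245) (Split 1 3 (Split
3 5 (Emb 4 264531 13452) (Split 3 4 (Emb 5 346152 21354) (Cover 0 2346 123 [:: Emb 0 261543 135426;
Emb 0 236154 231546; Emb 0 215436 154236; Emb 0 326154 213546; Emb 0 321546 215436; Emb 0 451236
451236]))) (Cover 6 12 1 [:: Emb 0 154236 541236; Emb 0 215436 154236])))) (Split 2 5 (Split 1 2
(Emb 4 325461 25413) (Split 1 4 (Emb 3 254631 54132) (Cover 0 1246 135 [:: Emb 0 154632 541326; Emb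
0 163254 132546; Emb 0 145236 145236; Emb 0 236154 231546; Emb 0 234516 234516; Emb 0 451236
451236]))) (Cover 0 246 13 [:: Emb 0 236154 231546; Emb 0 234516 234516; Emb 0 451236 451236]))))
(Cover 6 34 3 [:: Emb 0 321546 215436; Emb 0 451236 451236]))))));
(0%digits, Split 6 1 (Split 6 5 (Emb 5 562341 51234) (Split 6 2 (Emb 5 361542 21543) (Split 6 3 (Emb
6 123456 12345) (Split 6 4 (Emb 6 215436 15432) (Cover 6 12 1 [:: Emb 0 154326 543216; Emb 0 234516
234516]))))) (Split 6 2 (Split 6 3 (Emb 5 462153 32154) (Split 6 4 (Emb 6 234516 23451) (Split 6 5
(Emb 6 321546 21543) (Cover 6 23 2 [:: Emb 0 215436 154326; Emb 0 345126 345126])))) (Split 6 3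
(Split 6 4 (Emb 5 563214 43215) (Split 6 5 (Emb 6 154326 54321) (Cover 6 34 3 [:: Emb 0 321546
215436; Emb 0 451236 451236]))) (Split 6 4 (Split 6 5 (Emb 5 164325 54321) (Cover 6 45 4 [:: Emb 0
432156 321546; Emb 0 512346 512346])) (Split 6 5 (Cover 6 15 5 [:: Emb 0 123456 123456; Emb 0 543216
432156]) (Cover 6 23 1 [:: Cover 6 13 6 [:: Emb 0 154326 543267; Emb 0 345126 345167]; Cover 6 24 6
[:: Emb 0 215436 154367; Emb 0 451236 451267]]))))))].

(** Up to rotation and reflection, the subsets of six cyclic positions with at least two elements
    form one class each for sizes 6 and 5, and three each for sizes 4, 3 and 2. These are the eleven
    entries before the empty one. *)
Definition refutations7 : seq (Decimal.uint * refutation) :=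
[:: (123456%digits, Cover 0 1234567 123456 [:: Emb 0 1765432 1654327; Emb 0 1276543 1265437; Emb 0
1237654 1236547; Emb 0 1234765 1234657; Emb 0 1234576 1234567; Emb 0 1234567 1234567; Emb 0 2165473
1654327; Emb 0 2165734 1654237; Emb 0 2167345 1652347; Emb 0 2173456 1623457; Emb 0 2165437 1654327;
Emb 0 3216574 2165437; Emb 0 3216745 2165347; Emb 0 3217456 2163457; Emb 0 3216547 2165437; Emb 0
4321675 3216547; Emb 0 4321756 3216457; Emb 0 4321657 3216547; Emb 0 5432176 4321657; Emb 0 5432167
4321657; Emb 0 6543217 5432167]);
(12345%digits, Split 7 6 (Emb 1 1234567 123456) (Cover 0 1234567 123456 [:: Emb 0 1654372 6543217;
Emb 0 1654723 6543127; Emb 0 1657234 6541237; Emb 0 1672345 6512347; Split 7 7 (Emb 0 1654327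
6543217) (Split 2 7 (Emb 0 1654372 6543217) (Split 3 7 (Emb 0 1654723 6543127) (Split 4 7 (Emb 0
1657234 6541237) (Split 5 7 (Emb 0 1672345 6512347) (Split 2 6 (Emb 0 1654372 7543216) (Split 3 6
(Emb 0 1654723 7543126) (Split 4 6 (Emb 0 1657234 7541236) (Split 5 6 (Emb 0 1672345 7512346) (Cover
0 234567 12345 [:: Emb 0 2165473 1654328; Emb 0 2165734 1654238; Emb 0 2167345 1652348; Emb 0
2345716 2345168; Emb 0 2165437 1654328; Emb 0 3216574 2165438; Emb 0 3216745 2165348; Emb 0 3457216
3452168; Emb 0 3216547 2165438; Emb 0 4321675 3216548; Emb 0 4573216 4532168; Emb 0 4321657 3216548;
Emb 0 5743216 5432168; Emb 0 5432167 4321658; Emb 0 6123457 6123458]))))))))); Emb 0 1654327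
6543217; Emb 0 2165473 1654327; Emb 0 2165734 1654237; Emb 0 2167345 1652347; Emb 0 2345716 2345167;
Emb 0 2165437 1654327; Emb 0 3216574 2165437; Emb 0 3216745 2165347; Emb 0 3457216 3452167; Emb 0
3216547 2165437; Emb 0 4321675 3216547; Emb 0 4573216 4532167; Emb 0 4321657 3216547; Emb 0 5743216
5432167; Emb 0 5432167 4321657; Emb 0 6123457 6123457]));
(1245%digits, Split 7 3 (Emb 2 1234567 123456) (Split 7 6 (Emb 2 3216547 216543) (Cover 0 1234567
123456 [:: Emb 0 1654372 6543217; Split 7 7 (Emb 0 1654327 6543217) (Split 5 7 (Emb 0 1672345
6512347) (Split 5 2 (Emb 0 2743165 1437652) (Split 4 2 (Emb 0 2756134 1456732) (Split 5 1 (Emb 0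
2743165 2437651) (Split 4 1 (Emb 0 2756134 2456731) (Split 5 3 (Emb 0 4723165 4127653) (Split 5 6
(Emb 0 5431276 4371256) (Cover 0 457 45 [:: Emb 0 4321675 3216548; Emb 0 4321657 3216548; Emb 0
5432167 4321658])))))))); Emb 0 1657234 6541237; Emb 0 1672345 6512347; Split 7 7 (Emb 0 1654327
6543217) (Split 2 7 (Emb 0 1654372 6543217) (Split 4 7 (Emb 0 1657234 6541237) (Split 5 7 (Emb 0
1672345 6512347) (Split 2 6 (Emb 0 1654372 7543216) (Split 4 6 (Emb 0 1657234 7541236) (Split 5 6
(Emb 0 1672345 7512346) (Split 3 7 (Emb 0 3457216 3452167) (Split 3 6 (Emb 0 3457216 3452176) (Cover
0 123457 12345 [:: Emb 0 1654372 6543218; Split 7 8 (Emb 0 1654327 6543218) (Split 4 2 (Emb 0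
2756134 1456832) (Split 6 2 (Emb 0 2754316 1543862) (Split 4 1 (Emb 0 2756134 2456831) (Split 6 1
(Emb 0 2754316 2543861) (Split 6 8 (Emb 0 3457216 3452168) (Split 6 3 (Emb 0 4572316 4512863) (Cover
0 467 45 [:: Emb 0 4312756 3812459; Emb 0 4321657 3216549; Emb 0 6543127 5438129]))))))); Emb 0
1657234 6541238; Emb 0 1672345 6512348; Emb 0 1654327 6543218; Emb 0 2716543 2165438; Emb 0 2165734
1654238; Emb 0 2167345 1652348; Emb 0 2165437 1654328; Split 2 8 (Emb 0 2165734 1654238) (Split 2 3
(Emb 0 2165734 1654283) (Split 7 8 (Emb 0 3456127 3456128) (Split 6 8 (Emb 0 3457216 3452168) (Split
5 8 (Emb 0 3472165 3421658) (Split 6 3 (Emb 0 3457216 8452163) (Split 5 3 (Emb 0 3472165 8421653)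
(Cover 0 23567 1245 [:: Emb 0 2716543 2165439; Emb 0 2167345 1652349; Emb 0 2345716 2345169; Emb 0
2165437 1654329; Emb 0 3472165 3421659; Emb 0 3457216 3452169; Emb 0 3456127 3456129; Emb 0 5743216
5432169; Emb 0 5432167 4321659; Emb 0 6123457 6123459]))))))); Emb 0 3472165 3421658; Emb 0 3456127
3456128; Emb 0 4321675 3216548; Emb 0 4321657 3216548; Emb 0 5432167 4321658]))))))))); Emb 0
1654327 6543217; Emb 0 2716543 2165437; Emb 0 2165734 1654237; Emb 0 2167345 1652347; Emb 0 2345716
2345167; Emb 0 2165437 1654327; Split 1 7 (Emb 0 1657234 6541237) (Split 1 3 (Emb 0 1657234 6541273)
(Split 2 7 (Emb 0 2165734 1654237) (Split 2 3 (Emb 0 2165734 1654273) (Split 7 7 (Emb 0 3456127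
3456127) (Split 6 7 (Emb 0 3457216 3452167) (Split 5 7 (Emb 0 3472165 3421657) (Split 6 3 (Emb 0
3457216 7452163) (Split 5 3 (Emb 0 3472165 7421653) (Cover 0 123567 12456 [:: Emb 0 1654372 6543218;
Split 7 8 (Emb 0 1654327 6543218) (Split 4 2 (Emb 0 2756134 1456832) (Split 6 2 (Emb 0 2754316
1543862) (Split 4 1 (Emb 0 2756134 2456831) (Split 6 1 (Emb 0 2754316 2543861) (Split 6 8 (Emb 0
3457216 3452168) (Split 4 6 (Emb 0 4312756 3812456) (Cover 0 467 45 [:: Emb 0 4312756 3812459; Emb 0
4321657 3216549; Emb 0 6543127 5438129]))))))); Emb 0 1672345 6512348; Split 7 8 (Emb 0 1654327
6543218) (Split 2 8 (Emb 0 1654372 6543218) (Split 5 8 (Emb 0 1672345 6512348) (Split 2 6 (Emb 0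
1654372 8543216) (Split 5 6 (Emb 0 1672345 8512346) (Split 3 8 (Emb 0 3457216 3452168) (Split 3 6
(Emb 0 3457216 3452186) (Cover 0 23567 1245 [:: Emb 0 2716543 2165439; Emb 0 2167345 1652349; Emb 0
2345716 2345169; Emb 0 2165437 1654329; Emb 0 3472165 3421659; Emb 0 3457216 3452169; Emb 0 3456127
3456129; Emb 0 5743216 5432169; Emb 0 5432167 4321659; Emb 0 6123457 6123459]))))))); Emb 0 1654327
6543218; Emb 0 2716543 2165438; Emb 0 2167345 1652348; Emb 0 2345716 2345168; Emb 0 2165437 1654328;
Emb 0 3472165 3421658; Emb 0 3457216 3452168; Emb 0 3456127 3456128; Emb 0 5743216 5432168; Emb 0
5432167 4321658; Emb 0 6123457 6123458]))))))))); Emb 0 3472165 3421657; Emb 0 3457216 3452167; Emb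
0 3456127 3456127; Emb 0 4321675 3216547; Split 3 6 (Emb 0 1275643 1245736) (Split 2 5 (Emb 0
2164375 1673245) (Split 2 4 (Emb 0 2164375 1673254) (Split 2 3 (Emb 0 2164573 1674523) (Split 3 7
(Emb 0 3457216 3452167) (Split 3 5 (Emb 0 3461275 3761245) (Split 3 4 (Emb 0 3461275 3761254) (Split
7 7 (Emb 0 4321657 3216547) (Cover 0 237 12 [:: Emb 0 2164573 1674528; Emb 0 2165437 1654328; Emb 0
3216457 2167458])))))))); Emb 0 4321657 3216547; Emb 0 5743216 5432167; Emb 0 5432167 4321657; Emb 0
6123457 6123457])));
(1235%digits, Split 7 4 (Emb 2 1234567 123456) (Split 7 6 (Emb 2 4321657 321654) (Cover 0 1234567
123456 [:: Emb 0 1654372 6543217; Emb 0 1654723 6543127; Split 7 7 (Emb 0 1654327 6543217) (Split 3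
7 (Emb 0 1654723 6543127) (Split 5 7 (Emb 0 1672345 6512347) (Split 2 4 (Emb 0 2734165 1237654)
(Split 2 6 (Emb 0 2371456 2317456) (Split 3 4 (Emb 0 3274165 2137654) (Split 3 6 (Emb 0 3721456
3217456) (Split 6 7 (Emb 0 4573216 4532167) (Split 5 6 (Emb 0 5412376 4712356) (Split 6 4 (Emb 0
5723416 5123764) (Cover 0 23567 1235 [:: Emb 0 2165473 1654328; Emb 0 2167345 1652348; Emb 0 2345716
2345168; Emb 0 2165437 1654328; Emb 0 3216745 2165348; Emb 0 3275416 2154768; Emb 0 3216547 2165438;
Emb 0 5412376 4712358; Emb 0 5432167 4321658; Emb 0 6541237 5471238])))))))))); Emb 0 1672345
6512347; Split 7 7 (Emb 0 1654327 6543217) (Split 2 7 (Emb 0 1654372 6543217) (Split 3 7 (Emb 0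
1654723 6543127) (Split 5 7 (Emb 0 1672345 6512347) (Split 2 6 (Emb 0 1654372 7543216) (Split 3 6
(Emb 0 1654723 7543126) (Split 5 6 (Emb 0 1672345 7512346) (Split 4 7 (Emb 0 4573216 4532167) (Split
4 6 (Emb 0 4573216 4532176) (Cover 0 234567 12345 [:: Emb 0 2165473 1654328; Emb 0 2371654 2316548;
Emb 0 2167345 1652348; Emb 0 2345716 2345168; Emb 0 2165437 1654328; Emb 0 3721654 3216548; Emb 0
3216745 2165348; Emb 0 3457216 3452168; Emb 0 3216547 2165438; Split 1 8 (Emb 0 1672345 6512348)
(Split 1 4 (Emb 0 1672345 6512384) (Split 2 8 (Emb 0 2167345 1652348) (Split 2 4 (Emb 0 2167345
1652384) (Split 3 8 (Emb 0 3216745 2165348) (Split 3 4 (Emb 0 3216745 2165384) (Split 7 8 (Emb 0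
4561237 4561238) (Cover 0 12357 1235 [:: Emb 0 1654372 6543219; Emb 0 1654723 6543129; Emb 0 1672345
6512349; Emb 0 1654327 6543219; Emb 0 2165473 1654329; Emb 0 2167345 1652349; Emb 0 2165437 1654329;
Emb 0 3216745 2165349; Emb 0 3216547 2165439; Emb 0 5432167 4321659]))))))); Emb 0 4573216 4532168;
Emb 0 4561237 4561238; Split 1 4 (Emb 0 1657234 6851234) (Split 2 8 (Emb 0 2167345 1652348) (Split 2
5 (Emb 0 2165437 1684325) (Split 2 4 (Emb 0 2165734 1685234) (Split 3 8 (Emb 0 3216745 2165348)
(Split 3 5 (Emb 0 3216547 2168435) (Split 3 4 (Emb 0 3216574 2168534) (Split 4 8 (Emb 0 4573216
4532168) (Split 4 5 (Emb 0 4561237 4861235) (Cover 0 1234 123 [:: Emb 0 1765432 1584329; Emb 0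
1276543 1258439; Emb 0 1237654 1235849; Emb 0 2165473 1654329; Emb 0 2165734 1685239; Emb 0 3216574
2168539]))))))))); Emb 0 5432167 4321658; Emb 0 6123457 6123458]))))))))); Emb 0 1654327 6543217;
Emb 0 2165473 1654327; Emb 0 2371654 2316547; Emb 0 2167345 1652347; Emb 0 2345716 2345167; Emb 0
2165437 1654327; Emb 0 3721654 3216547; Emb 0 3216745 2165347; Emb 0 3457216 3452167; Emb 0 3216547
2165437; Split 1 7 (Emb 0 1672345 6512347) (Split 1 4 (Emb 0 1672345 6512374) (Split 2 7 (Emb 0
2167345 1652347) (Split 2 4 (Emb 0 2167345 1652374) (Split 3 7 (Emb 0 3216745 2165347) (Split 3 4
(Emb 0 3216745 2165374) (Split 7 7 (Emb 0 4561237 4561237) (Split 6 7 (Emb 0 4573216 4532167) (Split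
6 4 (Emb 0 4573216 7532164) (Cover 0 123567 12356 [:: Emb 0 1654372 6543218; Emb 0 1654723 6543128;
Emb 0 1672345 6512348; Split 7 8 (Emb 0 1654327 6543218) (Split 2 8 (Emb 0 1654372 6543218) (Split 3
8 (Emb 0 1654723 6543128) (Split 5 8 (Emb 0 1672345 6512348) (Split 2 6 (Emb 0 1654372 8543216)
(Split 3 6 (Emb 0 1654723 8543126) (Split 5 6 (Emb 0 1672345 8512346) (Cover 0 12357 1235 [:: Emb 0
1654372 6543219; Emb 0 1654723 6543129; Emb 0 1672345 6512349; Emb 0 1654327 6543219; Emb 0 2165473
1654329; Emb 0 2167345 1652349; Emb 0 2165437 1654329; Emb 0 3216745 2165349; Emb 0 3216547 2165439;
Emb 0 5432167 4321659]))))))); Emb 0 1654327 6543218; Emb 0 2165473 1654328; Emb 0 2167345 1652348;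
Emb 0 2345716 2345168; Emb 0 2165437 1654328; Emb 0 3216745 2165348; Emb 0 3457216 3452168; Emb 0
3216547 2165438; Split 3 6 (Emb 0 1276543 1258436) (Split 2 6 (Emb 0 1765432 1584326) (Split 1 5
(Emb 0 1654327 6843215) (Split 2 8 (Emb 0 2167345 1652348) (Split 2 5 (Emb 0 2165437 1684325) (Split
3 8 (Emb 0 3216745 2165348) (Split 3 5 (Emb 0 3216547 2168435) (Split 7 8 (Emb 0 5432167 4321658)
(Cover 0 1237 123 [:: Emb 0 1765432 1584329; Emb 0 1276543 1258439; Emb 0 1234567 1234859; Emb 0
2165473 1654329; Emb 0 2165437 1654329; Emb 0 3216547 2165439])))))))); Emb 0 5432167 4321658; Emb 0
6123457 6123458]))))))))); Emb 0 4573216 4532167; Emb 0 4561237 4561237; Split 4 6 (Emb 0 1237654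
1235746) (Split 3 6 (Emb 0 1276543 1257436) (Split 1 5 (Emb 0 1654327 6743215) (Split 1 4 (Emb 0
1657234 6751234) (Split 3 7 (Emb 0 3216745 2165347) (Split 3 5 (Emb 0 3216547 2167435) (Split 3 4
(Emb 0 3216574 2167534) (Split 4 7 (Emb 0 4573216 4532167) (Split 4 5 (Emb 0 4561237 4761235) (Split
7 7 (Emb 0 5432167 4321657) (Cover 0 1347 123 [:: Emb 0 1276543 1257438; Emb 0 1237654 1235748; Emb
0 1234567 1234758; Emb 0 3216574 2167538; Emb 0 3216547 2165438; Emb 0 4321657 3216758]))))))))));
Emb 0 5432167 4321657; Emb 0 6123457 6123457])));
(1234%digits, Split 7 5 (Emb 2 1234567 123456) (Split 7 6 (Emb 2 5432167 432165) (Split 2 5 (Cover 0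
1234567 123456 [:: Emb 0 1654372 6543217; Emb 0 1654723 6543127; Emb 0 1657234 6541237; Emb 0
1627345 6512347; Split 5 7 (Emb 0 1627345 6512347) (Split 7 7 (Emb 0 1654327 6543217) (Split 2 7
(Emb 0 1654372 6543217) (Split 3 7 (Emb 0 1654723 6543127) (Split 4 7 (Emb 0 1657234 6541237) (Split
5 6 (Emb 0 1627345 7512346) (Split 2 6 (Emb 0 1654372 7543216) (Split 3 6 (Emb 0 1654723 7543126)
(Split 4 6 (Emb 0 1657234 7541236) (Cover 0 234567 12345 [:: Emb 0 2165473 1654328; Emb 0 2165734
1654238; Emb 0 2347165 2341658; Emb 0 2543716 5432168; Emb 0 2165437 1654328; Emb 0 3216574 2165438;
Emb 0 3261745 2561348; Emb 0 3254716 2543168; Emb 0 3216547 2165438; Emb 0 4326175 3256148; Emb 0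
4325716 3254168; Emb 0 4321657 3216548; Emb 0 5234716 5234168; Emb 0 5432617 4325618; Emb 0 6125437
6154328]))))))))); Emb 0 1654327 6543217; Emb 0 2165473 1654327; Emb 0 2165734 1654237; Emb 0
2347165 2341657; Emb 0 2543716 5432167; Emb 0 2165437 1654327; Emb 0 3216574 2165437; Emb 0 3261745
2561347; Emb 0 3254716 2543167; Emb 0 3216547 2165437; Emb 0 4326175 3256147; Emb 0 4325716 3254167;
Emb 0 4321657 3216547; Emb 0 5234716 5234167; Emb 0 5432617 4325617; Emb 0 6125437 6154327]) (Split
3 5 (Split 3 6 (Emb 3 1654723 654321) (Cover 0 1234567 123456 [:: Emb 0 1654372 6543217; Emb 0
1654723 6543127; Emb 0 1657234 6541237; Emb 0 1632745 6521347; Split 5 7 (Emb 0 1632745 6521347)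
(Split 7 7 (Emb 0 1654327 6543217) (Split 2 7 (Emb 0 1654372 6543217) (Split 3 7 (Emb 0 1654723
6543127) (Split 4 7 (Emb 0 1657234 6541237) (Split 5 6 (Emb 0 1632745 7521346) (Split 2 6 (Emb 0
1654372 7543216) (Split 4 6 (Emb 0 1657234 7541236) (Cover 0 123457 12345 [:: Emb 0 1654372 6543218;
Emb 0 1654723 6543128; Emb 0 1657234 6541238; Emb 0 1632745 6521348; Emb 0 1654327 6543218; Emb 0
2165473 1654328; Emb 0 2165734 1654238; Emb 0 2163745 1652348; Emb 0 2165437 1654328; Emb 0 3216574
2165438; Emb 0 3472165 3421658; Emb 0 3216547 2165438; Emb 0 4361275 3561248; Emb 0 4321657 3216548;
Emb 0 5436127 4356128])))))))); Emb 0 1654327 6543217; Emb 0 2165473 1654327; Emb 0 2165734 1654237;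
Emb 0 2163745 1652347; Emb 0 2354716 2543167; Emb 0 2165437 1654327; Emb 0 3216574 2165437; Emb 0
3472165 3421657; Emb 0 3547216 5432167; Emb 0 3216547 2165437; Emb 0 4361275 3561247; Emb 0 4357216
3542167; Emb 0 4321657 3216547; Emb 0 5347216 5342167; Emb 0 5436127 4356127; Emb 0 6123547
6125437])) (Split 4 5 (Cover 0 1234567 123456 [:: Emb 0 1654372 6543217; Emb 0 1654723 6543127; Emb
0 1657234 6541237; Emb 0 1643275 6532147; Split 5 7 (Emb 0 1643275 6532147) (Split 7 7 (Emb 0
1654327 6543217) (Split 2 7 (Emb 0 1654372 6543217) (Split 3 7 (Emb 0 1654723 6543127) (Split 4 7
(Emb 0 1657234 6541237) (Split 5 6 (Emb 0 1643275 7532146) (Split 2 6 (Emb 0 1654372 7543216) (Split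
3 6 (Emb 0 1654723 7543126) (Split 4 6 (Emb 0 1657234 7541236) (Cover 0 234567 12345 [:: Emb 0
2165473 1654328; Emb 0 2165734 1654238; Emb 0 2164375 1653248; Emb 0 2345716 2354168; Emb 0 2165437
1654328; Emb 0 3216574 2165438; Emb 0 3216475 2165348; Emb 0 3457216 3542168; Emb 0 3216547 2165438;
Emb 0 4732165 4321658; Emb 0 4573216 5432168; Emb 0 4321657 3216548; Emb 0 5473216 5432168; Emb 0
5461237 4561238; Emb 0 6123457 6123548]))))))))); Emb 0 1654327 6543217; Emb 0 2165473 1654327; Emb
0 2165734 1654237; Emb 0 2164375 1653247; Emb 0 2345716 2354167; Emb 0 2165437 1654327; Emb 0
3216574 2165437; Emb 0 3216475 2165347; Emb 0 3457216 3542167; Emb 0 3216547 2165437; Emb 0 4732165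
4321657; Emb 0 4573216 5432167; Emb 0 4321657 3216547; Emb 0 5473216 5432167; Emb 0 5461237 4561237;
Emb 0 6123457 6123547]) (Split 2 6 (Split 1 5 (Cover 0 1234567 123456 [:: Emb 0 1734562 1234567; Emb
0 1265473 1654327; Emb 0 1265734 1654237; Emb 0 1743265 1432657; Emb 0 1543726 5432167; Emb 0
1265437 1654327; Emb 0 2165473 1654327; Emb 0 2165734 1654237; Emb 0 2347165 2341657; Emb 0 2734516
1234567; Emb 0 2165437 1654327; Emb 0 3216574 2165437; Emb 0 3261745 2651347; Emb 0 3274516 2134567;
Emb 0 3216547 2165437; Emb 0 4326175 3265147; Emb 0 4327516 3214567; Emb 0 4321657 3216547; Emb 0
5437216 4321657; Emb 0 5432617 4326517; Emb 0 6543217 5432617]) (Cover 0 123457 12346 [:: Emb 0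
1734562 1234567; Emb 0 1265473 1654327; Emb 0 1265734 1654237; Emb 0 1743265 1432657; Emb 0 1265437
1654327; Emb 0 2165473 1654327; Emb 0 2165734 1654237; Emb 0 2347165 2341657; Emb 0 2165437 1654327;
Emb 0 3216574 2165437; Emb 0 3472165 3421657; Emb 0 3216547 2165437; Emb 0 4732165 4321657; Emb 0
4321657 3216547; Emb 0 5612347 5612347])) (Split 3 6 (Split 1 5 (Cover 0 1234567 123456 [:: Emb 0
1745632 1345627; Emb 0 1274563 1234567; Emb 0 1236574 1265437; Emb 0 1274365 1243657; Emb 0 1547236
5431267; Emb 0 1236547 1265437; Emb 0 2165473 1654327; Emb 0 2165734 1654237; Emb 0 2163745 1562347;
Emb 0 2154736 1543267; Emb 0 2165437 1654327; Emb 0 3216574 2165437; Emb 0 3472165 3421657; Emb 0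
3274516 2134567; Emb 0 3216547 2165437; Emb 0 4361275 3651247; Emb 0 4327516 3214567; Emb 0 4321657
3216547; Emb 0 5472316 4312657; Emb 0 5436127 4365127; Emb 0 6543127 5436127]) (Cover 0 123457 12346
[:: Emb 0 1745632 1345627; Emb 0 1274563 1234567; Emb 0 1236574 1265437; Emb 0 1274365 1243657; Emb
0 1236547 1265437; Emb 0 2165473 1654327; Emb 0 2165734 1654237; Emb 0 2347165 2341657; Emb 0
2165437 1654327; Emb 0 3216574 2165437; Emb 0 3472165 3421657; Emb 0 3216547 2165437; Emb 0 4732165
4321657; Emb 0 4321657 3216547; Emb 0 5612347 5612347])) (Split 4 6 (Split 1 5 (Cover 0 1234567
123456 [:: Emb 0 1756432 1456327; Emb 0 1275643 1245637; Emb 0 1237564 1234567; Emb 0 1237465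
1234657; Emb 0 1572346 5412367; Emb 0 1234657 1236547; Emb 0 2165473 1654327; Emb 0 2165734 1654237;
Emb 0 2164375 1563247; Emb 0 2157346 1542367; Emb 0 2165437 1654327; Emb 0 3216574 2165437; Emb 0
3216475 2156347; Emb 0 3215746 2154367; Emb 0 3216547 2165437; Emb 0 4732165 4321657; Emb 0 4327516
3214567; Emb 0 4321657 3216547; Emb 0 5723416 4123657; Emb 0 5461237 4651237; Emb 0 6541237
5461237]) (Cover 0 123457 12346 [:: Emb 0 1756432 1456327; Emb 0 1275643 1245637; Emb 0 1237564
1234567; Emb 0 1237465 1234657; Emb 0 1234657 1236547; Emb 0 2165473 1654327; Emb 0 2165734 1654237;
Emb 0 2347165 2341657; Emb 0 2165437 1654327; Emb 0 3216574 2165437; Emb 0 3472165 3421657; Emb 0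
3216547 2165437; Emb 0 4732165 4321657; Emb 0 4321657 3216547; Emb 0 5612347 5612347])) (Cover 0
23457 1234 [:: Emb 0 2165473 1654327; Emb 0 2165734 1654237; Emb 0 2347165 2341657; Emb 0 2165437
1654327; Emb 0 3216574 2165437; Emb 0 3472165 3421657; Emb 0 3216547 2165437; Emb 0 4732165 4321657;
Emb 0 4321657 3216547; Emb 0 5612347 5612347])))))))));
(123%digits, Split 7 4 (Emb 5 1234567 123456) (Split 7 5 (Emb 4 1234567 123456) (Split 7 6 (Emb 5
4321657 321654) (Split 2 6 (Split 2 4 (Emb 4 3716542 216543) (Split 2 5 (Emb 5 3716542 216543)
(Split 1 4 (Split 1 5 (Emb 5 7265431 165432) (Cover 0 1234567 123456 [:: Emb 0 1734562 1234567; Emb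
0 1265473 1654327; Emb 0 1732654 1326547; Emb 0 1437265 4321657; Emb 0 1273456 6123457; Emb 0
1265437 1654327; Emb 0 2165473 1654327; Emb 0 2371654 2316547; Emb 0 2734165 1234657; Emb 0 2173456
6123457; Emb 0 2165437 1654327; Emb 0 3265174 2654137; Emb 0 3274165 2134657; Emb 0 3217456 2613457;
Emb 0 3216547 2165437; Emb 0 4173265 4132657; Emb 0 4372156 3216457; Emb 0 4326517 3265417; Split 1
7 (Emb 0 1437265 4321657) (Split 2 7 (Emb 0 2734165 1234657) (Split 3 7 (Emb 0 3274165 2134657)
(Split 3 5 (Emb 0 3274165 2134675) (Split 4 7 (Emb 0 4372156 3216457) (Split 4 5 (Emb 0 4372156
3216475) (Split 7 7 (Emb 0 5614327 5643217) (Cover 0 123467 12346 [:: Emb 0 1734562 1234568; Emb 0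
1265473 1654328; Emb 0 1732654 1326548; Emb 0 1273456 6123458; Emb 0 1265437 1654328; Emb 0 2165473
1654328; Emb 0 2371654 2316548; Emb 0 2173456 6123458; Emb 0 2165437 1654328; Emb 0 3265174 2654138;
Emb 0 3217456 2613458; Emb 0 3216547 2165438; Emb 0 4372156 3216458; Emb 0 4326517 3265418; Emb 0
6543217 5432618]))))))); Emb 0 5614327 5643217; Emb 0 6543217 5432617])) (Split 3 4 (Split 3 5 (Emb
5 2745613 234561) (Cover 0 1234567 123456 [:: Emb 0 1734562 1234567; Emb 0 1265473 1654327; Emb 0
1265374 1654237; Emb 0 1743265 1342657; Emb 0 1273456 6123457; Emb 0 1265437 1654327; Emb 0 2165473
1654327; Emb 0 2165374 1654237; Emb 0 2347165 2431657; Emb 0 2173456 6123457; Emb 0 2165437 1654327;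
Emb 0 3721654 3216547; Emb 0 3472165 4321657; Emb 0 3217456 2613457; Emb 0 3216547 2165437; Emb 0
4372165 4321657; Emb 0 4712356 3162457; Emb 0 4356127 3456127; Split 1 7 (Emb 0 1743265 1342657)
(Split 1 5 (Emb 0 1743265 1342675) (Split 2 7 (Emb 0 2347165 2431657) (Split 3 7 (Emb 0 3217456
2613457) (Split 4 7 (Emb 0 4712356 3162457) (Split 4 5 (Emb 0 4712356 3162475) (Split 7 7 (Emb 0
5612347 5612437) (Cover 0 123457 12346 [:: Emb 0 1734562 1234568; Emb 0 1265473 1654328; Emb 0
1265374 1654238; Emb 0 1743265 1342658; Emb 0 1265437 1654328; Emb 0 2165473 1654328; Emb 0 2165374
1654238; Emb 0 2347165 2431658; Emb 0 2165437 1654328; Emb 0 3721654 3216548; Emb 0 3472165 4321658;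
Emb 0 3216547 2165438; Emb 0 4372165 4321658; Emb 0 4356127 3456128; Emb 0 5612347 5612438])))))));
Emb 0 5612347 5612437; Emb 0 6543217 5432617])) (Split 1 5 (Cover 0 1234567 123456 [:: Emb 0 1734562
1234567; Emb 0 1265473 1654327; Emb 0 1732654 1326547; Emb 0 1627345 5612347; Emb 0 1543726 5432167;
Emb 0 1265437 1654327; Emb 0 2165473 1654327; Emb 0 2371654 2316547; Emb 0 2617345 6512347; Emb 0
2734516 1234567; Emb 0 2165437 1654327; Emb 0 3721654 3216547; Emb 0 3261745 2651347; Emb 0 3274516
2134567; Emb 0 3216547 2165437; Split 1 7 (Emb 0 1732654 1326547) (Split 2 7 (Emb 0 2371654 2316547)
(Split 3 7 (Emb 0 3261745 2651347) (Split 6 7 (Emb 0 4517326 4513267) (Split 7 7 (Emb 0 4561237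
4561237) (Split 6 4 (Emb 0 4517326 7513264) (Cover 0 123567 12356 [:: Emb 0 1734562 1234568; Emb 0
1265473 1654328; Emb 0 1627345 5612348; Emb 0 1543726 5432168; Emb 0 1265437 1654328; Emb 0 2165473
1654328; Emb 0 2617345 6512348; Emb 0 2734516 1234568; Emb 0 2165437 1654328; Emb 0 3261745 2651348;
Emb 0 3274516 2134568; Emb 0 3216547 2165438; Emb 0 5437216 4321658; Emb 0 5432617 4326518; Emb 0
6543217 5432618])))))); Emb 0 4517326 4513267; Emb 0 4561237 4561237; Emb 0 5437216 4321657; Emb 0
5432617 4326517; Emb 0 6543217 5432617]) (Split 3 5 (Cover 0 1234567 123456 [:: Emb 0 1734562
1234567; Emb 0 1265473 1654327; Emb 0 1732654 1326547; Emb 0 1263745 1652347; Emb 0 1745326 1345267;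
Emb 0 1265437 1654327; Emb 0 2165473 1654327; Emb 0 2371654 2316547; Emb 0 2163745 1652347; Emb 0
2354716 2543167; Emb 0 2165437 1654327; Emb 0 3721654 3216547; Emb 0 3612745 5612347; Emb 0 3217456
2613457; Emb 0 3216547 2165437; Split 1 7 (Emb 0 1263745 1652347) (Split 2 7 (Emb 0 2163745 1652347)
(Split 3 7 (Emb 0 3721654 3216547) (Split 6 7 (Emb 0 4537216 4532167) (Split 7 7 (Emb 0 4561237
4561237) (Split 6 4 (Emb 0 4537216 7532164) (Cover 0 123467 12356 [:: Emb 0 1734562 1234568; Emb 0
1265473 1654328; Emb 0 1732654 1326548; Emb 0 1745326 1345268; Emb 0 1265437 1654328; Emb 0 2165473
1654328; Emb 0 2371654 2316548; Emb 0 2354716 2543168; Emb 0 2165437 1654328; Emb 0 3721654 3216548;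
Emb 0 3217456 2613458; Emb 0 3216547 2165438; Emb 0 4537216 4532168; Emb 0 4561237 4561238; Emb 0
6543217 5432618])))))); Emb 0 4537216 4532167; Emb 0 4561237 4561237; Emb 0 5471236 4316257; Emb 0
5436127 4356127; Emb 0 6543217 5432617]) (Cover 0 12347 1236 [:: Emb 0 1734562 1234567; Emb 0
1265473 1654327; Emb 0 1732654 1326547; Emb 0 1265437 1654327; Emb 0 2165473 1654327; Emb 0 2371654
2316547; Emb 0 2165437 1654327; Emb 0 3721654 3216547; Emb 0 3216547 2165437; Emb 0 4561237
4561237]))))))) (Split 1 4 (Split 2 4 (Split 2 5 (Emb 3 1734562 123456) (Split 3 5 (Split 3 6 (Emb 3
1654723 654321) (Cover 0 1234567 123456 [:: Emb 0 1654372 6543217; Emb 0 1654723 6543127; Emb 0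
1652734 6541237; Emb 0 1632745 6521347; Split 5 7 (Emb 0 1632745 6521347) (Split 4 7 (Emb 0 1652734
6541237) (Split 7 7 (Emb 0 1654327 6543217) (Split 2 7 (Emb 0 1654372 6543217) (Split 3 7 (Emb 0
1654723 6543127) (Split 5 6 (Emb 0 1632745 7521346) (Split 4 6 (Emb 0 1652734 7541236) (Cover 0
234567 12345 [:: Emb 0 2165473 1654328; Emb 0 2371654 2316548; Emb 0 2163745 1652348; Emb 0 2354716
2543168; Emb 0 2165437 1654328; Emb 0 3256174 2456138; Emb 0 3274165 2134658; Emb 0 3547216 5432168;
Emb 0 3216547 2165438; Emb 0 4372165 3214658; Emb 0 4352716 3542168; Emb 0 4325617 3245618; Emb 0
5327416 5213468; Emb 0 5436127 4356128; Emb 0 6123547 6125438]))))))); Emb 0 1654327 6543217; Emb 0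
2165473 1654327; Emb 0 2371654 2316547; Emb 0 2163745 1652347; Emb 0 2354716 2543167; Emb 0 2165437
1654327; Emb 0 3256174 2456137; Emb 0 3274165 2134657; Emb 0 3547216 5432167; Emb 0 3216547 2165437;
Emb 0 4372165 3214657; Emb 0 4352716 3542167; Emb 0 4325617 3245617; Emb 0 5327416 5213467; Emb 0
5436127 4356127; Emb 0 6123547 6125437])) (Split 4 5 (Split 4 6 (Emb 4 1652374 654231) (Cover 0
1234567 123456 [:: Emb 0 1654372 6543217; Emb 0 1654723 6543127; Emb 0 1652734 6541237; Emb 0
1643725 6532147; Split 5 7 (Emb 0 1643725 6532147) (Split 4 7 (Emb 0 1652734 6541237) (Split 7 7
(Emb 0 1654327 6543217) (Split 2 7 (Emb 0 1654372 6543217) (Split 3 7 (Emb 0 1654723 6543127) (Split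
5 6 (Emb 0 1643725 7532146) (Split 3 6 (Emb 0 1654723 7543126) (Cover 0 123457 12345 [:: Emb 0
1654372 6543218; Emb 0 1654723 6543128; Emb 0 1652734 6541238; Emb 0 1643725 6532148; Emb 0 1654327
6543218; Emb 0 2165473 1654328; Emb 0 2371654 2316548; Emb 0 2734165 1234658; Emb 0 2165437 1654328;
Emb 0 3256174 2456138; Emb 0 3274165 2134658; Emb 0 3216547 2165438; Emb 0 4372165 3214658; Emb 0
4325617 3245618; Emb 0 5164327 4653218]))))))); Emb 0 1654327 6543217; Emb 0 2165473 1654327; Emb 0
2371654 2316547; Emb 0 2734165 1234657; Emb 0 2734516 1235467; Emb 0 2165437 1654327; Emb 0 3256174
2456137; Emb 0 3274165 2134657; Emb 0 3274516 2135467; Emb 0 3216547 2165437; Emb 0 4372165 3214657;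
Emb 0 4523716 5423167; Emb 0 4325617 3245617; Emb 0 5437216 5321467; Emb 0 5164327 4653217; Emb 0
6125437 6145327])) (Split 3 6 (Split 1 5 (Emb 4 4563271 456213) (Cover 0 123457 12346 [:: Emb 0
1745632 1345627; Emb 0 1274563 1234567; Emb 0 1273654 1236547; Emb 0 1247365 1432657; Emb 0 1236547
1265437; Emb 0 2165473 1654327; Emb 0 2156374 1456237; Emb 0 2147365 1432657; Emb 0 2165437 1654327;
Emb 0 3256174 2456137; Emb 0 3274165 2134657; Emb 0 3216547 2165437; Emb 0 4372165 3214657; Emb 0
4325617 3245617; Emb 0 5612437 5614327])) (Split 4 6 (Split 1 5 (Emb 5 7256431 145632) (Cover 0
123467 12346 [:: Emb 0 1734652 1236547; Emb 0 1256473 1456327; Emb 0 1732564 1324567; Emb 0 1437256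
6321457; Emb 0 1256437 1456327; Emb 0 2156473 1456327; Emb 0 2371564 2314567; Emb 0 2734156 1236457;
Emb 0 2156437 1456327; Emb 0 3256174 2456137; Emb 0 3274156 2136457; Emb 0 3215647 2145637; Emb 0
4173256 6132457; Emb 0 4325617 3245617; Emb 0 6514327 5463217])) (Cover 0 12347 1234 [:: Emb 0
1654372 6543217; Emb 0 1654723 6543127; Emb 0 1652734 6541237; Emb 0 1654327 6543217; Emb 0 2165473
1654327; Emb 0 2371654 2316547; Emb 0 2165437 1654327; Emb 0 3256174 2456137; Emb 0 3216547 2165437;
Emb 0 4325617 3245617])))))) (Split 3 4 (Split 3 5 (Emb 5 2745613 234561) (Split 3 6 (Emb 4 2745613
234561) (Split 1 5 (Split 4 6 (Emb 4 4653271 654213) (Split 5 6 (Split 2 5 (Emb 5 7265431 156432)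
(Split 4 5 (Emb 4 4653271 564213) (Cover 0 23467 1234 [:: Emb 0 2165473 1564327; Emb 0 2165374
1564237; Emb 0 2734156 1234567; Emb 0 2165437 1564327; Emb 0 3721654 3215647; Emb 0 3274156 2134567;
Emb 0 3216547 2156437; Emb 0 4723156 3124567; Emb 0 4356127 3456127; Emb 0 6154327 5643217])))
(Cover 0 123457 12345 [:: Emb 0 1654372 6543217; Emb 0 1654723 6543127; Emb 0 1653274 6542137; Split
4 7 (Emb 0 1653274 6542137) (Split 7 7 (Emb 0 1654327 6543217) (Split 2 7 (Emb 0 1654372 6543217)
(Split 3 7 (Emb 0 1654723 6543127) (Split 2 5 (Emb 0 2734516 1234765) (Split 4 5 (Emb 0 4723516
3124765) (Cover 0 23467 1234 [:: Emb 0 2165473 1654328; Emb 0 2165374 1654238; Emb 0 2734156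
1234758; Emb 0 2165437 1654328; Emb 0 3721654 3216548; Emb 0 3274156 2134758; Emb 0 3216547 2165438;
Emb 0 4723156 3124758; Emb 0 4356127 3456128; Emb 0 6154327 5743218])))))); Emb 0 1654327 6543217;
Emb 0 2165473 1654327; Emb 0 2165374 1654237; Emb 0 2734165 1234657; Emb 0 2165437 1654327; Emb 0
3721654 3216547; Emb 0 3274165 2134657; Emb 0 3216547 2165437; Emb 0 4723165 3124657; Emb 0 4356127
3456127; Emb 0 5612347 5612437]))) (Split 4 6 (Split 1 3 (Emb 4 2746531 136542) (Split 1 2 (Emb 4
7235641 124563) (Cover 1 27 1 [:: Emb 0 1746532 1365427; Emb 0 1235647 1245637]))) (Split 2 5 (Split
2 3 (Emb 4 1734562 123456) (Split 1 3 (Split 5 6 (Emb 4 3456271 346512) (Cover 0 123457 12345 [::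
Emb 0 1654372 6543217; Emb 0 1654723 6543127; Emb 0 1653274 6542137; Emb 0 1627345 6512347; Emb 0
1654327 6543217; Emb 0 2165473 1654327; Emb 0 2165374 1654237; Emb 0 2734165 1234657; Emb 0 2165437
1654327; Emb 0 3271654 2136547; Emb 0 3274165 2134657; Emb 0 3216547 2165437; Emb 0 4162735 3651247;
Emb 0 4165327 3654217; Emb 0 5432617 4325617])) (Cover 0 127 12 [:: Emb 0 1654372 6543217; Emb 0
1654327 6543217; Emb 0 2165437 1654327]))) (Cover 0 12347 1234 [:: Emb 0 1654372 6543217; Emb 0
1654723 6543127; Emb 0 1653274 6542137; Emb 0 1654327 6543217; Emb 0 2165473 1654327; Emb 0 2165374
1654237; Emb 0 2165437 1654327; Emb 0 3721654 3216547; Emb 0 3216547 2165437; Emb 0 4356127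
3456127])))))) (Split 2 5 (Split 2 3 (Emb 4 1734562 123456) (Cover 0 1234567 123456 [:: Emb 0
1654372 6543217; Emb 0 1654723 6543127; Split 5 7 (Emb 0 1627345 6512347) (Split 7 7 (Emb 0 1654327
6543217) (Split 6 3 (Emb 0 3725416 2154763) (Split 5 3 (Emb 0 3726145 2156743) (Split 6 7 (Emb 0
4372516 3215467) (Split 5 6 (Emb 0 5143726 4732156) (Split 6 4 (Emb 0 5273416 5123764) (Cover 0 2567
125 [:: Emb 0 2734165 1234658; Emb 0 2734156 1237458; Emb 0 2165437 1654328; Emb 0 5143726 4732158;
Emb 0 5432617 4325618; Emb 0 6514327 5473218]))))))); Emb 0 1627345 6512347; Split 5 7 (Emb 0
1627345 6512347) (Split 7 7 (Emb 0 1654327 6543217) (Split 2 7 (Emb 0 1654372 6543217) (Split 3 7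
(Emb 0 1654723 6543127) (Split 5 6 (Emb 0 1627345 7512346) (Split 3 6 (Emb 0 1654723 7543126) (Split
4 7 (Emb 0 4372516 3215467) (Split 4 6 (Emb 0 4372516 3215476) (Cover 0 234567 12345 [:: Emb 0
2165473 1654328; Emb 0 2371654 2316548; Emb 0 2734165 1234658; Emb 0 2543716 5432168; Emb 0 2165437
1654328; Emb 0 3721654 3216548; Emb 0 3274165 2134658; Emb 0 3254716 2543168; Emb 0 3216547 2165438;
Emb 0 4372615 3215648; Emb 0 4372516 3215468; Emb 0 4561237 4561238; Emb 0 5273416 5123468; Emb 0
5432617 4325618; Emb 0 6125437 6154328])))))))); Emb 0 1654327 6543217; Emb 0 2165473 1654327; Emb 0
2371654 2316547; Emb 0 2734165 1234657; Emb 0 2543716 5432167; Emb 0 2165437 1654327; Emb 0 3721654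
3216547; Emb 0 3274165 2134657; Emb 0 3254716 2543167; Emb 0 3216547 2165437; Emb 0 4372615 3215647;
Emb 0 4372516 3215467; Emb 0 4561237 4561237; Emb 0 5273416 5123467; Emb 0 5432617 4325617; Emb 0
6125437 6154327])) (Split 3 5 (Split 3 6 (Emb 3 1654723 654321) (Split 1 5 (Split 5 6 (Emb 4 4563271
465213) (Split 4 5 (Split 4 6 (Split 6 2 (Emb 4 3546271 546213) (Split 5 2 (Emb 4 3645271 564213)
(Split 5 3 (Emb 4 5463271 465213) (Split 6 4 (Emb 4 3564721 546312) (Split 6 3 (Emb 4 6453271
645213) (Cover 0 567 15 [:: Emb 0 5127346 4123567; Emb 0 5123647 4125637; Emb 0 6514327
5463217])))))) (Cover 0 234567 12345 [:: Emb 0 2165473 1654327; Emb 0 2371654 2316547; Emb 0 2163745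
1652347; Emb 0 2734516 1234567; Emb 0 2165437 1654327; Emb 0 3721654 3216547; Emb 0 3274165 2134657;
Emb 0 3274516 2134567; Emb 0 3216547 2165437; Emb 0 4723615 3125647; Emb 0 4723516 3125467; Emb 0
4561237 4561237; Emb 0 5472316 4312567; Emb 0 5164327 4653217; Emb 0 6123547 6125437])) (Cover 0
2347 123 [:: Emb 0 2165473 1654327; Emb 0 2371654 2316547; Emb 0 2165437 1654327; Emb 0 3721654
3216547; Emb 0 3216547 2165437; Emb 0 4561237 4561237]))) (Cover 0 1237 123 [:: Emb 0 1654372
6543217; Emb 0 1654723 6543127; Emb 0 1654327 6543217; Emb 0 2165473 1654327; Emb 0 2165437 1654327;
Emb 0 3216547 2165437]))) (Split 3 6 (Split 1 3 (Emb 4 2745631 134562) (Split 1 5 (Emb 4 4563271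
456213) (Split 1 2 (Emb 4 7236541 126543) (Cover 1 27 1 [:: Emb 0 1745632 1345627; Emb 0 1236547
1265437])))) (Cover 0 1237 123 [:: Emb 0 1654372 6543217; Emb 0 1654723 6543127; Emb 0 1654327
6543217; Emb 0 2165473 1654327; Emb 0 2165437 1654327; Emb 0 3216547 2165437])))))) (Split 1 5
(Split 2 4 (Split 2 3 (Emb 5 1734562 123456) (Split 2 5 (Emb 3 1734562 123456) (Split 1 3 (Split 3 6
(Emb 3 3654721 654312) (Split 4 6 (Emb 4 3465271 365412) (Split 5 6 (Split 3 5 (Emb 3 3654721
564312) (Split 4 5 (Emb 4 3465271 356412) (Cover 0 23467 1234 [:: Emb 0 2165473 1564327; Emb 0
2731654 1235647; Emb 0 2734516 1234567; Emb 0 2165437 1564327; Emb 0 3271654 2135647; Emb 0 3274516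
2134567; Emb 0 3216547 2156437; Emb 0 4372516 3214567; Emb 0 4325617 3245617; Emb 0 6154327
5643217]))) (Cover 0 234567 12345 [:: Emb 0 2165473 1654327; Emb 0 2731654 1236547; Emb 0 2437165
4321657; Emb 0 2734516 1234567; Emb 0 2165437 1654327; Emb 0 3271654 2136547; Emb 0 3247165 2431657;
Emb 0 3274516 2134567; Emb 0 3216547 2165437; Emb 0 4273165 4123657; Emb 0 4372516 3214567; Emb 0
4325617 3245617; Split 4 5 (Emb 0 1652734 6741235) (Split 3 5 (Emb 0 1654723 6743125) (Split 2 7
(Emb 0 2734516 1234567) (Split 3 7 (Emb 0 3274516 2134567) (Split 4 7 (Emb 0 4372516 3214567) (Split
7 7 (Emb 0 5612437 5614327) (Cover 0 23467 1234 [:: Emb 0 2165473 1574328; Emb 0 2731654 1235748;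
Emb 0 2734516 1234568; Emb 0 2165437 1574328; Emb 0 3271654 2135748; Emb 0 3274516 2134568; Emb 0
3216547 2157438; Emb 0 4372516 3214568; Emb 0 4325617 3245618; Emb 0 6154327 6543218])))))); Emb 0
5612437 5614327; Emb 0 6154327 6543217])))) (Cover 0 127 12 [:: Emb 0 1654372 6543217; Emb 0 1654327
6543217; Emb 0 2165437 1654327])))) (Split 3 4 (Split 3 5 (Emb 5 2745613 234561) (Split 3 6 (Emb 4
2745613 234561) (Split 2 5 (Cover 0 1234567 123456 [:: Emb 0 1654372 6543217; Emb 0 1654723 6543127;
Emb 0 1653274 6542137; Emb 0 1627345 6512347; Split 5 7 (Emb 0 1627345 6512347) (Split 4 7 (Emb 0
1653274 6542137) (Split 7 7 (Emb 0 1654327 6543217) (Split 2 7 (Emb 0 1654372 6543217) (Split 3 7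
(Emb 0 1654723 6543127) (Split 5 6 (Emb 0 1627345 7512346) (Split 4 6 (Emb 0 1653274 7542136) (Cover
0 123457 12345 [:: Emb 0 1654372 6543218; Emb 0 1654723 6543128; Emb 0 1653274 6542138; Emb 0
1627345 6512348; Emb 0 1654327 6543218; Emb 0 2165473 1654328; Emb 0 2165374 1654238; Emb 0 2347165
2431658; Emb 0 2165437 1654328; Emb 0 3721654 3216548; Emb 0 3261745 2561348; Emb 0 3216547 2165438;
Emb 0 4716235 3165248; Emb 0 4356127 3456128; Emb 0 5432617 4325618]))))))); Emb 0 1654327 6543217;
Emb 0 2165473 1654327; Emb 0 2165374 1654237; Emb 0 2347165 2431657; Emb 0 2734516 1234567; Emb 0
2165437 1654327; Emb 0 3721654 3216547; Emb 0 3261745 2561347; Emb 0 3274516 2134567; Emb 0 3216547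
2165437; Emb 0 4716235 3165247; Emb 0 4352716 3452167; Emb 0 4356127 3456127; Emb 0 5437216 4321567;
Emb 0 5432617 4325617; Emb 0 6125437 6154327]) (Cover 0 1237 123 [:: Emb 0 1654372 6543217; Emb 0
1654723 6543127; Emb 0 1654327 6543217; Emb 0 2165473 1654327; Emb 0 2165437 1654327; Emb 0 3216547
2165437])))) (Split 2 5 (Split 6 4 (Cover 0 1234567 123456 [:: Emb 0 1654372 6543217; Emb 0 1654723
6543127; Emb 0 1652734 6451237; Emb 0 1643725 6432157; Split 5 7 (Emb 0 1643725 6432157) (Split 4 7
(Emb 0 1652734 6451237) (Split 7 7 (Emb 0 1654327 6543217) (Split 2 7 (Emb 0 1654372 6543217) (Split
3 7 (Emb 0 1654723 6543127) (Split 5 6 (Emb 0 1643725 7432156) (Split 4 6 (Emb 0 1652734 7451236)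
(Split 3 6 (Emb 0 1654723 7543126) (Cover 0 123457 12345 [:: Emb 0 1654372 6543218; Emb 0 1654723
6543128; Emb 0 1652734 6451238; Emb 0 1643725 6432158; Emb 0 1654327 6543218; Emb 0 2165473 1654328;
Emb 0 2371654 2316548; Emb 0 2734615 1234658; Emb 0 2165437 1654328; Emb 0 3256174 2546138; Emb 0
3274615 2134658; Emb 0 3216547 2165438; Emb 0 4372165 3215648; Emb 0 4325617 3254618; Emb 0 5432617
4325618])))))))); Emb 0 1654327 6543217; Emb 0 2165473 1654327; Emb 0 2371654 2316547; Emb 0 2734615
1234657; Emb 0 2734516 1234567; Emb 0 2165437 1654327; Emb 0 3256174 2546137; Emb 0 3274615 2134657;
Emb 0 3274516 2134567; Emb 0 3216547 2165437; Emb 0 4372165 3215647; Emb 0 4523716 4523167; Emb 0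
4325617 3254617; Emb 0 5437216 4321567; Emb 0 5432617 4325617; Emb 0 6125437 6154327]) (Cover 0
123567 12356 [:: Emb 0 1654372 6543217; Emb 0 1654723 6543127; Emb 0 1627345 6512347; Split 7 7 (Emb
0 1654327 6543217) (Split 2 7 (Emb 0 1654372 6543217) (Split 3 7 (Emb 0 1654723 6543127) (Split 3 6
(Emb 0 1654723 7543126) (Split 4 7 (Emb 0 4523716 4523167) (Split 4 6 (Emb 0 4523716 4523176) (Cover
0 23467 1235 [:: Emb 0 2165473 1654328; Emb 0 2371654 2316548; Emb 0 2734516 1234568; Emb 0 2165437
1654328; Emb 0 3721654 3216548; Emb 0 3274516 2134568; Emb 0 3216547 2165438; Emb 0 4523716 4523168;
Emb 0 4561237 4561238; Emb 0 6125437 6154328])))))); Emb 0 1654327 6543217; Emb 0 2165473 1654327;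
Emb 0 2617345 5612347; Emb 0 2734516 1234567; Emb 0 2165437 1654327; Emb 0 3261745 2561347; Emb 0
3274516 2134567; Emb 0 3216547 2165437; Emb 0 5437216 4321567; Emb 0 5432617 4325617; Emb 0 6125437
6154327])) (Split 3 5 (Split 3 6 (Emb 3 1654723 654321) (Split 4 5 (Split 5 6 (Split 1 3 (Emb 3
2745631 134652) (Split 1 2 (Emb 5 7236541 125643) (Cover 1 27 1 [:: Emb 0 1745632 1346527; Emb 0
1236547 1256437]))) (Cover 0 12357 1235 [:: Emb 0 1654372 6543217; Emb 0 1654723 6543127; Emb 0
1632745 6521347; Emb 0 1654327 6543217; Emb 0 2165473 1654327; Emb 0 2163745 1652347; Emb 0 2165437
1654327; Emb 0 3721645 3216547; Emb 0 3216547 2165437; Emb 0 5436127 4356127])) (Cover 0 2347 123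
[:: Emb 0 2165473 1654327; Emb 0 2371654 2316547; Emb 0 2165437 1654327; Emb 0 3721654 3216547; Emb
0 3216547 2165437; Emb 0 4561237 4561237]))) (Split 3 6 (Split 1 3 (Emb 3 2745631 134562) (Split 1 2
(Emb 5 7236541 126543) (Cover 1 27 1 [:: Emb 0 1745632 1345627; Emb 0 1236547 1265437]))) (Cover 0
2347 123 [:: Emb 0 2165473 1654327; Emb 0 2371654 2316547; Emb 0 2165437 1654327; Emb 0 3721654
3216547; Emb 0 3216547 2165437; Emb 0 4561237 4561237])))))) (Split 3 6 (Split 3 1 (Emb 5 4721653
321654) (Split 3 4 (Emb 4 2745613 234561) (Split 3 5 (Emb 3 1654723 654321) (Split 2 4 (Split 2 5
(Emb 3 1734562 123456) (Split 4 5 (Split 4 1 (Emb 3 1732564 132456) (Split 4 6 (Emb 4 1652374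
654231) (Cover 0 347 23 [:: Emb 0 3256174 2456137; Emb 0 3216547 2165437; Emb 0 4325617 3245617])))
(Cover 0 123467 12346 [:: Emb 0 1745632 1345627; Emb 0 1274563 1234567; Emb 0 1273654 1236547; Emb 0
1327456 6213457; Emb 0 1236547 1265437; Emb 0 2165473 1654327; Emb 0 2371654 2316547; Emb 0 2137456
1623457; Emb 0 2165437 1654327; Emb 0 3256174 2456137; Emb 0 3127456 6123457; Emb 0 3216547 2165437;
Emb 0 4317256 3612457; Emb 0 4325617 3245617; Emb 0 6543127 5436127]))) (Split 2 5 (Split 2 3 (Emb 4
1734562 123456) (Split 4 5 (Split 1 3 (Split 6 4 (Split 4 1 (Emb 5 6521734 451326) (Split 4 6 (Emb 4
2563714 546231) (Split 4 2 (Emb 3 1736524 326451) (Split 6 1 (Emb 5 4521376 451623) (Split 6 3 (Emb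
4 2547316 543261) (Split 6 2 (Emb 3 1374526 623451) (Cover 0 246 45 [:: Emb 0 2173654 1326457; Emb 0
2137456 1623457; Emb 0 4137256 3621547]))))))) (Cover 0 123467 12356 [:: Emb 0 1745632 1345627; Emb
0 1274563 1234567; Emb 0 1273654 1236547; Emb 0 1254736 1543267; Emb 0 1236547 1265437; Emb 0
2165473 1654327; Emb 0 2173654 1326547; Emb 0 2137456 1623457; Emb 0 2145637 1345627; Emb 0 3271654
2136547; Emb 0 3254716 2543167; Emb 0 3216547 2165437; Emb 0 4521736 4513267; Emb 0 4561237 4561237;
Emb 0 6541327 5436217])) (Cover 0 127 12 [:: Emb 0 1745632 1345627; Emb 0 1236547 1265437; Emb 0
2165437 1654327])) (Cover 0 12347 1236 [:: Emb 0 1745632 1345627; Emb 0 1274563 1234567; Emb 0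
1273654 1236547; Emb 0 1236547 1265437; Emb 0 2165473 1654327; Emb 0 2371654 2316547; Emb 0 2165437
1654327; Emb 0 3721654 3216547; Emb 0 3216547 2165437; Emb 0 4561237 4561237]))) (Cover 0 12347 1236
[:: Emb 0 1745632 1345627; Emb 0 1274563 1234567; Emb 0 1273654 1236547; Emb 0 1236547 1265437; Emb
0 2165473 1654327; Emb 0 2371654 2316547; Emb 0 2165437 1654327; Emb 0 3721654 3216547; Emb 0
3216547 2165437; Emb 0 4561237 4561237])))))) (Split 2 4 (Split 2 3 (Emb 5 1734562 123456) (Split 2
5 (Emb 3 1734562 123456) (Split 1 3 (Split 3 4 (Split 3 5 (Emb 5 2745613 234561) (Split 4 6 (Split 4
5 (Emb 5 1653724 654321) (Cover 0 123467 12346 [:: Emb 0 1734652 1236547; Emb 0 1274653 1236547; Emb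
0 1273564 1234567; Emb 0 1437256 6321457; Emb 0 1235647 1245637; Emb 0 2165473 1654327; Emb 0
2173564 1324567; Emb 0 2147356 1632457; Emb 0 2146537 1365427; Emb 0 3271654 2136547; Emb 0 3271456
2136457; Emb 0 3216547 2165437; Emb 0 4127356 6123457; Emb 0 4165327 3654217; Emb 0 6521437
5416327])) (Cover 0 12347 1234 [:: Emb 0 1654372 6543217; Emb 0 1654723 6543127; Emb 0 1652734
6541237; Emb 0 1654327 6543217; Emb 0 2165473 1654327; Emb 0 2165374 1654237; Emb 0 2165437 1654327;
Emb 0 3271654 2136547; Emb 0 3216547 2165437; Emb 0 4165327 3654217]))) (Cover 0 1237 123 [:: Emb 0
1654372 6543217; Emb 0 1654723 6543127; Emb 0 1654327 6543217; Emb 0 2165473 1654327; Emb 0 2165437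
1654327; Emb 0 3216547 2165437])) (Cover 0 127 12 [:: Emb 0 1654372 6543217; Emb 0 1654327 6543217;
Emb 0 2165437 1654327])))) (Split 2 5 (Split 2 3 (Emb 4 1734562 123456) (Split 1 3 (Split 3 5 (Split
3 4 (Emb 5 2745613 234561) (Split 5 6 (Cover 0 1234567 123456 [:: Emb 0 1734562 1234657; Emb 0
1274563 1234657; Emb 0 1273654 1235647; Emb 0 1627345 6512347; Emb 0 1237456 1523467; Emb 0 1236547
1256437; Emb 0 2165473 1654327; Emb 0 2173654 1325647; Emb 0 2163745 1652347; Emb 0 2154736 1643257;
Emb 0 2145637 1346527; Emb 0 3271654 2136547; Emb 0 3261745 2561347; Emb 0 3254716 2543167; Emb 0
3216547 2165437; Split 1 7 (Emb 0 1273654 1235647) (Split 2 7 (Emb 0 2173654 1325647) (Split 3 7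
(Emb 0 3271654 2136547) (Split 6 7 (Emb 0 4527316 4512367) (Split 7 7 (Emb 0 4561237 4561237) (Split
6 4 (Emb 0 4527316 7512364) (Cover 0 123467 12356 [:: Emb 0 1734562 1234658; Emb 0 1274563 1234658;
Emb 0 1273654 1235648; Emb 0 1237456 1523468; Emb 0 1236547 1256438; Emb 0 2165473 1654328; Emb 0
2173654 1325648; Emb 0 2154736 1643258; Emb 0 2145637 1346528; Emb 0 3271654 2136548; Emb 0 3254716
2543168; Emb 0 3216547 2165438; Emb 0 4527316 4512368; Emb 0 4561237 4561238; Emb 0 6215437
5164328])))))); Emb 0 4527316 4512367; Emb 0 4561237 4561237; Emb 0 5432716 4352167; Emb 0 5416327
4365217; Emb 0 6215437 5164327]) (Cover 0 12357 1235 [:: Emb 0 1654372 6543217; Emb 0 1654723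
6543127; Emb 0 1627345 6512347; Emb 0 1654327 6543217; Emb 0 2165473 1654327; Emb 0 2163745 1652347;
Emb 0 2165437 1654327; Emb 0 3261745 2561347; Emb 0 3216547 2165437; Emb 0 5416327 4365217])))
(Cover 0 1237 123 [:: Emb 0 1654372 6543217; Emb 0 1654723 6543127; Emb 0 1654327 6543217; Emb 0
2165473 1654327; Emb 0 2165437 1654327; Emb 0 3216547 2165437])) (Cover 0 127 12 [:: Emb 0 1654372
6543217; Emb 0 1654327 6543217; Emb 0 2165437 1654327]))) (Cover 0 1237 123 [:: Emb 0 1654372
6543217; Emb 0 1654723 6543127; Emb 0 1654327 6543217; Emb 0 2165473 1654327; Emb 0 2165437 1654327;
Emb 0 3216547 2165437]))))))))));
(124%digits, Split 2 3 (Emb 6 1734562 123456) (Split 2 6 (Emb 6 3716542 216543) (Split 7 3 (Emb 5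
1234567 123456) (Split 7 5 (Emb 3 1234567 123456) (Split 7 6 (Emb 4 3216547 216543) (Split 2 4
(Split 2 5 (Emb 3 1734562 123456) (Split 5 3 (Split 3 1 (Emb 6 1374562 124356) (Split 3 4 (Emb 6
1734562 124356) (Split 3 5 (Emb 6 2436175 435612) (Cover 3 27 2 [:: Emb 0 2165473 1653427; Emb 0
3216547 2165347])))) (Split 4 5 (Split 5 1 (Emb 6 1573462 142356) (Split 5 2 (Emb 6 3571642 241653)
(Cover 5 27 4 [:: Emb 0 2164375 1653247; Emb 0 5216437 4165327]))) (Split 4 6 (Split 1 4 (Emb 6
3715642 214563) (Split 1 2 (Emb 6 5713462 412365) (Cover 1 27 1 [:: Emb 0 1734652 1236547; Emb 0
1234657 1236547]))) (Cover 0 2457 124 [:: Emb 0 2165734 1654237; Emb 0 2347165 2341657; Emb 0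
2165437 1654327; Emb 0 4327165 3241657; Emb 0 4321657 3216547; Emb 0 5612347 5612347]))))) (Split 3
4 (Split 5 3 (Emb 6 2745613 243561) (Split 1 4 (Split 4 6 (Emb 6 3215647 214563) (Split 2 5 (Split 5
1 (Emb 6 6573412 512346) (Split 5 6 (Emb 6 4162735 465123) (Split 6 3 (Split 3 5 (Emb 6 1735462
125436) (Split 3 1 (Emb 3 1725463 125436) (Cover 0 357 24 [:: Emb 0 3746125 2436157; Emb 0 3254617
2543617; Emb 0 5432617 4325617]))) (Cover 0 24567 1245 [:: Emb 0 2165734 1654237; Emb 0 2734165
1234657; Emb 0 2543716 5432167; Emb 0 2165437 1654327; Emb 0 4327165 3214657; Emb 0 4325716 3254167;
Emb 0 4321657 3216547; Emb 0 5273416 5123467; Emb 0 5432617 4325617; Emb 0 6125437 6154327]))))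
(Split 4 5 (Split 5 6 (Emb 6 2756431 146532) (Split 5 2 (Emb 6 1253467 124356) (Split 5 1 (Emb 6
3251647 214653) (Cover 5 27 4 [:: Emb 0 2164375 1653247; Emb 0 5164327 4653217])))) (Cover 0 2457
124 [:: Emb 0 2165734 1654237; Emb 0 2734165 1234657; Emb 0 2165437 1654327; Emb 0 4327165 3214657;
Emb 0 4321657 3216547; Emb 0 5612347 5612347])))) (Split 1 5 (Split 2 5 (Split 5 6 (Emb 6 5627341
651234) (Split 6 3 (Split 4 6 (Emb 6 5173642 512364) (Split 4 2 (Emb 6 6475213 324516) (Split 4 5
(Emb 6 2536174 543612) (Split 4 1 (Emb 6 3245167 214563) (Cover 4 57 4 [:: Emb 0 4326175 3256147;
Emb 0 4321657 3216547]))))) (Split 3 6 (Split 5 1 (Emb 6 2563471 156342) (Split 5 2 (Emb 6 3627541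
651243) (Cover 5 12 5 [:: Emb 0 1274365 1243657; Emb 0 2347165 2341657]))) (Cover 0 23567 1245 [::
Emb 0 2716543 2165437; Emb 0 2347165 2341657; Emb 0 2734516 1234567; Emb 0 2165437 1654327; Emb 0
3472165 3421657; Emb 0 3452716 3452167; Emb 0 3456127 3456127; Emb 0 5437216 4321567; Emb 0 5432617
4325617; Emb 0 6125437 6154327])))) (Cover 0 127 12 [:: Emb 0 1654372 6543217; Emb 0 1654327
6543217; Emb 0 2165437 1654327])) (Cover 0 127 12 [:: Emb 0 1654372 6543217; Emb 0 1654327 6543217;
Emb 0 2165437 1654327])))) (Split 2 5 (Split 3 5 (Split 6 3 (Emb 6 5371642 521634) (Split 5 3 (Emb 6
7436125 435612) (Split 5 2 (Emb 6 1254367 124356) (Split 6 4 (Split 1 4 (Split 5 1 (Emb 6 6573412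
512346) (Split 5 6 (Emb 6 4162735 465123) (Cover 5 23 5 [:: Emb 0 2734165 1234657; Emb 0 3461725
3461257]))) (Split 1 5 (Split 5 6 (Emb 6 5627341 651234) (Split 5 1 (Emb 6 1573462 512346) (Cover 5
13 5 [:: Emb 0 1643725 6432157; Emb 0 3461725 3461257]))) (Cover 0 127 12 [:: Emb 0 1654372 6543217;
Emb 0 1654327 6543217; Emb 0 2165437 1654327]))) (Split 3 6 (Split 6 2 (Emb 6 5671342 521634) (Split
1 3 (Split 5 6 (Emb 6 1736542 125643) (Cover 0 256 15 [:: Emb 0 2147365 1342657; Emb 0 2735416
1254367; Emb 0 5417236 4312567])) (Cover 0 124567 12456 [:: Emb 0 1654372 6543217; Emb 0 1275634
1245637; Emb 0 1274365 1243657; Emb 0 1725436 1254367; Emb 0 1654327 6543217; Emb 0 2165734 1654237;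
Emb 0 2347165 2341657; Emb 0 2713456 2163457; Emb 0 2165437 1654327; Emb 0 4326175 3256147; Emb 0
4325716 3254167; Emb 0 4321657 3216547; Emb 0 5432716 4352167; Emb 0 5432617 4325617; Emb 0 6543127
5436127]))) (Cover 0 2367 125 [:: Emb 0 2716543 2165437; Emb 0 2543716 5432167; Emb 0 2165437
1654327; Emb 0 3452716 3452167; Emb 0 3456127 3456127; Emb 0 6125437 6154327])))))) (Cover 0 237 12
[:: Emb 0 2716543 2165437; Emb 0 2165437 1654327; Emb 0 3456127 3456127])) (Cover 0 237 12 [:: Emb 0
2716543 2165437; Emb 0 2165437 1654327; Emb 0 3456127 3456127])))))))));
(* No two rows of this [J] are consecutive, so [x] cannot be exchanged directly with a cycle vertex.
   Once enlargements of [J] are ruled out, the tree has to branch on incidences among the cycle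
   vertices and rows themselves. *)
(135%digits, Split 7 2 (Emb 4 1234567 123456) (Split 7 4 (Emb 4 3456127 345612) (Split 7 6 (Emb 4
2165437 165432) (Split 1 3 (Split 3 6 (Emb 7 4723651 312654) (Split 3 1 (Split 2 6 (Emb 7 4732651
312654) (Split 1 2 (Emb 6 1274563 213456) (Split 5 2 (Emb 7 1254763 124356) (Split 4 2 (Emb 6
1724563 312456) (Split 6 2 (Emb 7 7261453 126345) (Split 1 5 (Split 5 6 (Emb 4 5672341 651234)
(Split 1 4 (Split 5 3 (Emb 7 3416725 346512) (Split 5 1 (Emb 7 2761435 156432) (Split 6 4 (Split 4 6
(Emb 2 3465721 364512) (Cover 0 24567 1345 [:: Emb 0 2316574 2164537; Emb 0 2316475 2164357; Emb 0
2374516 2134567; Emb 0 2316547 2165437; Emb 0 4327165 3215647; Emb 0 4327516 3215467; Emb 0 4321657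
3216457; Emb 0 5432716 4321567; Emb 0 5432167 4321657; Emb 0 6123457 6123457])) (Cover 5 67 5 [::
Emb 0 5432716 4321567; Emb 0 5432167 4321657])))) (Split 3 4 (Split 4 6 (Emb 5 2746531 136542)
(Cover 0 34567 1345 [:: Emb 0 3271654 2136547; Emb 0 3216745 2165347; Emb 0 3274516 2134567; Emb 0
3216547 2165437; Emb 0 4167235 3651247; Emb 0 4723516 3124567; Emb 0 4165327 3654217; Emb 0 5432716
4321567; Emb 0 5432167 4321657; Emb 0 6123457 6123457])) (Cover 0 1357 135 [:: Emb 0 1654723
6543127; Emb 0 1672345 6512347; Emb 0 1654327 6543217; Emb 0 3216745 2165347; Emb 0 3216547 2165437;
Emb 0 5432167 4321657])))) (Split 3 5 (Split 5 6 (Emb 7 2745631 134652) (Split 2 5 (Split 3 4 (Split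
4 6 (Emb 6 2746531 136542) (Cover 0 13457 1345 [:: Emb 0 1654723 6543127; Emb 0 1653274 6542137; Emb
0 1623745 6521347; Emb 0 1654327 6543217; Emb 0 3271654 2136547; Emb 0 3216745 2165347; Emb 0
3216547 2165437; Emb 0 4167235 3651247; Emb 0 4165327 3654217; Emb 0 5416237 4365217])) (Split 6 4
(Split 4 6 (Emb 7 6432751 632154) (Split 4 5 (Emb 6 3756124 354612) (Split 4 1 (Emb 7 3716524
316452) (Cover 4 37 3 [:: Emb 0 3216574 2164537; Emb 0 4165237 3645217])))) (Cover 0 3567 135 [::
Emb 0 3216745 2165347; Emb 0 3275416 2154367; Emb 0 3216547 2165437; Emb 0 5432716 4325167; Emb 0
5416237 4365217; Emb 0 6123457 6123457]))) (Split 1 4 (Split 5 3 (Emb 7 3416725 346512) (Split 5 1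
(Emb 7 2761435 156432) (Cover 5 12 4 [:: Emb 0 1632745 6521347; Emb 0 2316745 2165347]))) (Cover 0
127 13 [:: Emb 0 1654732 6543127; Emb 0 1654327 6543217; Emb 0 2316547 2165437])))) (Split 1 4
(Split 5 6 (Emb 4 3456721 346512) (Split 5 3 (Emb 7 3416725 346512) (Split 5 1 (Emb 7 2761435
156432) (Cover 5 13 4 [:: Emb 0 1672345 6512347; Emb 0 3216745 2165347])))) (Cover 0 137 13 [:: Emb
0 1654723 6543127; Emb 0 1654327 6543217; Emb 0 3216547 2165437]))))))))) (Split 6 1 (Split 2 6 (Emb
7 7623451 162345) (Split 4 6 (Emb 7 4623751 612354) (Split 3 5 (Split 5 6 (Emb 7 2745631 134652)
(Split 5 2 (Emb 7 6745213 534216) (Split 4 2 (Emb 7 1754263 354216) (Split 5 1 (Split 1 2 (Emb 7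
4761253 356214) (Split 1 4 (Emb 7 2761435 156432) (Split 2 4 (Emb 7 6732415 152436) (Cover 0 1257
135 [:: Emb 0 1654732 6143527; Emb 0 1623745 6125347; Emb 0 1623457 6123457; Emb 0 2361745 2561347;
Emb 0 2345167 2341657; Emb 0 5416237 4361257])))) (Split 3 4 (Split 6 2 (Emb 4 7541623 543621)
(Split 4 1 (Emb 7 1723564 312456) (Cover 0 3456 345 [:: Emb 0 3261754 2163547; Emb 0 3216745
2165347; Emb 0 3275416 2154367; Emb 0 4167235 3651247; Emb 0 4753216 3542167; Emb 0 5473216
4352167]))) (Cover 0 357 35 [:: Emb 0 3216745 2165347; Emb 0 3216547 2165437; Emb 0 5416237
4361257])))))) (Split 6 2 (Split 2 3 (Emb 7 4361752 326154) (Split 3 4 (Emb 7 5416273 436215) (Split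
5 2 (Split 6 3 (Split 1 2 (Split 5 6 (Emb 4 4327651 321564) (Split 5 3 (Split 1 4 (Emb 4 1432765
432156) (Split 2 4 (Emb 4 2431675 432651) (Cover 0 12357 1235 [:: Emb 0 1675432 6154327; Emb 0
1627543 6215437; Emb 0 1672345 6512347; Emb 0 1623457 6123457; Emb 0 2167453 1653427; Emb 0 2761345
1562347; Emb 0 2163457 1623457; Emb 0 3216745 2165347; Emb 0 3216457 2163457; Emb 0 5432167
4321657]))) (Cover 3 25 2 [:: Emb 0 2167453 1653427; Emb 0 3216745 2165347]))) (Cover 3 17 3 [:: Emb
0 1627543 6215437; Emb 0 3216457 2163457])) (Cover 3 26 2 [:: Emb 0 2167453 1653427; Emb 0 3275416
2154367])) (Cover 3 57 3 [:: Emb 0 3216745 2165347; Emb 0 3216547 2165437])))) (Split 3 4 (Split 5 6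
(Emb 7 2657431 165342) (Split 1 2 (Emb 7 5472163 431265) (Split 5 2 (Emb 6 2547613 243561) (Split 4
2 (Emb 7 2457163 245361) (Cover 0 13457 1345 [:: Emb 0 1654723 6543127; Emb 0 1623754 6123547; Emb 0
1623475 6124357; Emb 0 1623457 6123457; Emb 0 3261754 2163547; Emb 0 3216745 2165347; Emb 0 3216547
2165437; Emb 0 4167235 3651247; Emb 0 4162357 3612457; Emb 0 5432167 4321657]))))) (Cover 3 67 3 [::
Emb 0 3275416 2154367; Emb 0 3216547 2165437])))))) (Split 6 2 (Split 2 6 (Emb 7 7263451 162345)
(Split 2 5 (Emb 7 5716342 516234) (Split 2 3 (Emb 7 4361752 326154) (Split 3 4 (Emb 7 5416273
436215) (Split 2 4 (Split 4 1 (Emb 7 5416372 416235) (Split 4 2 (Emb 7 5437162 423165) (Split 4 5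
(Emb 6 2573614 453261) (Cover 4 37 3 [:: Emb 0 3271654 2136547; Emb 0 4325617 3245617])))) (Cover 2
36 2 [:: Emb 0 2754163 1543627; Emb 0 2345716 2345167])))))) (Split 3 4 (Split 5 2 (Emb 6 2547613
243561) (Split 5 6 (Emb 7 1674325 653421) (Split 5 1 (Emb 7 6723415 512436) (Cover 0 3567 345 [::
Emb 0 3216745 2165347; Emb 0 3275416 2154367; Emb 0 3216547 2165437; Emb 0 5723416 5124367; Emb 0
5432167 4321657; Emb 0 6123457 6123457])))) (Cover 0 367 35 [:: Emb 0 3275416 2154367; Emb 0 3216547
2165437; Emb 0 6123457 6123457])))))) (Split 5 3 (Split 1 4 (Emb 7 3416725 346512) (Split 3 4 (Emb 6
3476125 435612) (Split 1 5 (Split 3 6 (Emb 7 5632741 562134) (Split 4 6 (Emb 6 4672351 651234)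
(Split 6 4 (Emb 7 3461725 346512) (Split 1 2 (Split 2 4 (Emb 7 3427615 341562) (Split 2 6 (Split 6 2
(Emb 5 3627541 261543) (Split 4 1 (Emb 5 4762351 156234) (Split 6 1 (Emb 5 3267541 261543) (Cover 0
467 35 [:: Emb 0 4531726 4325167; Emb 0 4531267 4321657; Emb 0 6543127 5432617])))) (Cover 0 23467
1235 [:: Emb 0 2745613 1345627; Emb 0 2731654 1326547; Emb 0 2754316 1543267; Emb 0 2345617 2345617;
Emb 0 3216754 2165347; Emb 0 3274516 2134567; Emb 0 3216547 2165437; Emb 0 4532716 4321567; Emb 0
4532167 4321657; Emb 0 6123457 6123457]))) (Split 4 2 (Split 3 1 (Emb 7 1245763 124356) (Split 3 5
(Emb 7 6754213 534216) (Cover 3 17 3 [:: Emb 0 1654273 6542137; Emb 0 3216547 2165437]))) (Cover 0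
1347 135 [:: Emb 0 1654723 6543127; Emb 0 1672354 6512347; Emb 0 1654327 6543217; Emb 0 3216754
2165347; Emb 0 3216547 2165437; Emb 0 4532167 4321657])))))) (Split 5 6 (Split 1 2 (Emb 7 3276541
215643) (Split 3 6 (Split 4 6 (Split 6 4 (Emb 7 1657324 645321) (Split 6 1 (Emb 7 2145736 164532)
(Split 3 1 (Split 6 2 (Emb 4 4126753 612534) (Split 5 2 (Emb 4 6125473 612435) (Cover 0 13567 1356
[:: Emb 0 1654723 6543127; Emb 0 1237645 1235647; Emb 0 1237546 1235467; Emb 0 1234567 1234657; Emb
0 3216745 2165347; Emb 0 3214576 2164357; Emb 0 3216547 2165437; Emb 0 5412376 4612357; Emb 0
5432167 4321657; Emb 0 6541237 5461237]))) (Cover 1 36 6 [:: Emb 0 1654723 6543127; Emb 0 1237546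
1235467])))) (Cover 1 47 1 [:: Emb 0 1237654 1235647; Emb 0 1234567 1234657])) (Cover 1 37 1 [:: Emb
0 1654723 6543127; Emb 0 1234567 1234657]))) (Split 1 2 (Split 3 6 (Emb 6 7236541 126543) (Split 4 6
(Emb 7 3276451 215643) (Split 3 1 (Emb 6 1274563 213456) (Split 2 4 (Emb 7 3427615 341562) (Split 4
1 (Split 2 6 (Emb 7 3267451 265143) (Split 2 5 (Emb 7 4761352 156234) (Split 3 5 (Emb 7 5761243
356214) (Cover 0 1237 123 [:: Emb 0 1654732 6541327; Emb 0 1654723 6543127; Emb 0 1654237 6541237;
Emb 0 2457613 1435627; Emb 0 2453167 1432657; Emb 0 3216547 2165437])))) (Cover 1 34 2 [:: Emb 0
1654723 6543127; Emb 0 1672354 6512347])))))) (Cover 1 57 1 [:: Emb 0 1672345 6512347; Emb 0 1654327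
6543217])))))) (Split 1 4 (Split 5 6 (Emb 7 4567231 465123) (Split 5 1 (Emb 7 2761435 156432) (Split
6 4 (Split 4 6 (Emb 7 4657231 645123) (Split 4 2 (Emb 7 2375614 235461) (Split 4 5 (Emb 6 3756124
354612) (Split 4 1 (Split 2 5 (Emb 7 3716524 316452) (Split 2 4 (Emb 7 1732564 132456) (Cover 0 247
13 [:: Emb 0 2371654 2316547; Emb 0 2341657 2316457; Emb 0 4321657 3216457]))) (Cover 4 15 4 [:: Emb
0 1657234 6451237; Emb 0 4327615 3215647]))))) (Split 5 2 (Split 3 1 (Emb 7 1254763 124356) (Split 3
4 (Emb 6 2547613 243561) (Split 3 5 (Emb 7 6745213 534216) (Split 6 2 (Split 2 6 (Emb 7 6275431
615432) (Split 2 3 (Emb 7 4361752 326154) (Cover 3 25 2 [:: Emb 0 2167453 1653427; Emb 0 3216745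
2165347]))) (Cover 5 67 5 [:: Emb 0 5723416 5123467; Emb 0 5432167 4321657]))))) (Cover 5 67 5 [::
Emb 0 5723416 5123467; Emb 0 5432167 4321657]))))) (Split 5 6 (Split 1 5 (Emb 6 2765431 156432)
(Split 1 2 (Emb 7 3276541 215643) (Split 4 6 (Split 6 4 (Emb 7 1657324 645321) (Split 6 1 (Emb 7
2145736 164532) (Split 6 3 (Emb 7 3754126 354612) (Split 5 2 (Split 3 1 (Emb 7 1254763 124356)
(Cover 1 36 6 [:: Emb 0 1254673 1246537; Emb 0 1237546 1235467])) (Cover 0 1567 156 [:: Emb 0
1237645 1235647; Emb 0 1237546 1235467; Emb 0 1234567 1234657; Emb 0 5412376 4612357; Emb 0 5432167
4321657; Emb 0 6541237 5461237]))))) (Cover 1 47 1 [:: Emb 0 1237654 1235647; Emb 0 1234567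
1234657])))) (Split 1 2 (Split 3 6 (Emb 6 7236541 126543) (Split 3 1 (Emb 6 1274563 213456) (Split 3
4 (Emb 7 5472163 431265) (Split 5 2 (Split 3 5 (Emb 7 6745213 534216) (Cover 3 15 2 [:: Emb 0
1654723 6543127; Emb 0 3216745 2165347])) (Cover 0 157 15 [:: Emb 0 1672345 6512347; Emb 0 1654327
6543217; Emb 0 5432167 4321657]))))) (Cover 0 157 15 [:: Emb 0 1672345 6512347; Emb 0 1654327
6543217; Emb 0 5432167 4321657])))))))));
(12%digits, Split 2 3 (Emb 6 1734562 123456) (Split 2 4 (Emb 7 1734562 123456) (Split 2 5 (Emb 7
3716542 216543) (Split 2 6 (Emb 6 3716542 216543) (Split 7 3 (Emb 6 1234567 123456) (Split 7 4 (Emb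
7 1234567 123456) (Split 7 5 (Emb 7 3216547 216543) (Split 7 6 (Emb 6 3216547 216543) (Cover 0 237
12 [:: Emb 0 2716543 2165437; Emb 0 2165437 1654327; Emb 0 3456127 3456127])))))))));
(13%digits, Split 7 6 (Emb 9 6723451 612345) (Split 7 2 (Emb 9 3716542 216543) (Split 7 4 (Emb 9
5732164 432165) (Split 7 5 (Emb 8 1234567 123456) (Split 3 1 (Split 1 2 (Emb 9 1374562 213456)
(Split 3 6 (Split 1 3 (Emb 7 4723651 312654) (Split 1 4 (Emb 8 2745631 134562) (Split 1 5 (Emb 7
5632741 562134) (Split 2 3 (Split 4 2 (Emb 9 7365421 165423) (Split 6 2 (Emb 7 4713652 316254)
(Split 6 3 (Split 2 5 (Emb 8 2547136 543162) (Split 2 4 (Split 4 5 (Emb 7 6523714 542316) (Cover 0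
12467 1346 [:: Emb 0 1745632 1345627; Emb 0 1723654 1326547; Emb 0 1327456 6213457; Emb 0 1236547
1265437; Emb 0 2371654 2316547; Emb 0 2317456 2613457; Emb 0 2316547 2165437; Emb 0 4713256 3162457;
Emb 0 4325617 3245617; Emb 0 6542317 5432617])) (Cover 0 1267 136 [:: Emb 0 1745632 1345627; Emb 0
1327456 6213457; Emb 0 1236547 1265437; Emb 0 2317456 2613457; Emb 0 2316547 2165437; Emb 0 6542317
5432617]))) (Cover 7 16 1 [:: Emb 0 1236547 1265437; Emb 0 6542317 5432617])))) (Cover 7 12 1 [::
Emb 0 1236547 1265437; Emb 0 2316547 2165437]))))) (Split 1 4 (Split 2 6 (Emb 8 2654731 654312)
(Split 5 2 (Emb 9 7356142 125643) (Split 3 4 (Split 4 6 (Emb 8 4653271 654213) (Split 4 1 (Split 1 3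
(Emb 7 1723564 312456) (Split 5 3 (Emb 7 5723164 312465) (Cover 7 15 1 [:: Emb 0 1653247 6542137;
Emb 0 5612347 5612437]))) (Split 5 1 (Split 2 5 (Emb 8 2614735 564312) (Split 4 5 (Emb 8 4613275
564213) (Split 4 2 (Split 2 4 (Emb 7 5437162 423165) (Split 1 3 (Emb 9 4371652 213654) (Cover 1 27 1
[:: Emb 0 1657342 6513427; Emb 0 1652347 6512437]))) (Cover 0 2457 134 [:: Emb 0 2371654 2316547;
Emb 0 2374165 2134657; Emb 0 2316547 2165437; Emb 0 4723165 3124657; Emb 0 4165237 4651237; Emb 0
5612347 5612437])))) (Cover 7 45 3 [:: Emb 0 4561237 4561237; Emb 0 5612347 5612437])))) (Split 1 5
(Split 3 5 (Split 5 6 (Emb 4 4563271 465213) (Split 5 3 (Emb 9 1572364 431256) (Split 5 1 (Emb 8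
1472365 431256) (Cover 5 37 5 [:: Emb 0 3274165 2134657; Emb 0 5614327 5643217])))) (Cover 0 137 13
[:: Emb 0 1654723 6543127; Emb 0 1654327 6543217; Emb 0 3216547 2165437])) (Cover 0 137 13 [:: Emb 0
1654723 6543127; Emb 0 1654327 6543217; Emb 0 3216547 2165437]))))) (Split 1 5 (Split 2 6 (Emb 7
5623741 562134) (Split 3 5 (Split 5 6 (Emb 7 5632741 652134) (Split 1 3 (Split 2 5 (Split 5 2 (Emb 7
5361742 256134) (Split 3 4 (Split 4 1 (Emb 7 1723564 312456) (Split 4 5 (Emb 7 3561724 456312)
(Split 5 1 (Emb 8 1743265 134256) (Cover 0 457 34 [:: Emb 0 4716235 3165247; Emb 0 4165327 3654217;
Emb 0 5416237 4365217])))) (Cover 0 1357 135 [:: Emb 0 1654723 6543127; Emb 0 1623745 6521347; Emb 0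
1654327 6543217; Emb 0 3261745 2561347; Emb 0 3216547 2165437; Emb 0 5416237 4365217]))) (Cover 0
127 13 [:: Emb 0 1654732 6543127; Emb 0 1654327 6543217; Emb 0 2316547 2165437])) (Split 6 3 (Split
4 6 (Emb 8 4672351 631254) (Split 4 2 (Emb 9 7345162 124563) (Split 2 5 (Split 5 3 (Split 2 4 (Emb 9
2571634 431652) (Cover 0 1247 135 [:: Emb 0 1654732 6543127; Emb 0 1672354 6312547; Emb 0 1645237
6345217; Emb 0 2376154 2136547; Emb 0 2316547 2165437; Emb 0 4532617 4325617])) (Cover 7 15 1 [::
Emb 0 1645237 6345217; Emb 0 5432617 4325617])) (Cover 1 27 1 [:: Emb 0 1654732 6543127; Emb 0
1645327 6345217])))) (Cover 7 16 1 [:: Emb 0 1654327 6543217; Emb 0 6123547 6125437])))) (Cover 0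
137 13 [:: Emb 0 1654723 6543127; Emb 0 1654327 6543217; Emb 0 3216547 2165437]))) (Cover 0 137 13
[:: Emb 0 1654723 6543127; Emb 0 1654327 6543217; Emb 0 3216547 2165437]))))) (Split 4 1 (Split 2 4
(Emb 7 1732564 132456) (Split 1 3 (Split 2 6 (Emb 7 4732651 132654) (Split 3 6 (Emb 7 4723651
312654) (Split 3 4 (Emb 7 1723564 312456) (Split 4 2 (Split 2 5 (Emb 8 1734562 132456) (Split 3 5
(Emb 8 1724563 312456) (Cover 0 2347 123 [:: Emb 0 2716543 1365427; Emb 0 2371654 2316547; Emb 0
2165437 1654237; Emb 0 3271654 2136547; Emb 0 3216547 2165437; Emb 0 4561237 4561237]))) (Split 3 5
(Split 5 6 (Emb 7 2745631 134652) (Split 1 2 (Emb 8 1274563 213456) (Split 2 5 (Split 5 2 (Emb 7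
5361742 256134) (Split 1 4 (Split 6 1 (Emb 7 3761524 316452) (Cover 7 36 3 [:: Emb 0 3216547
2165437; Emb 0 6123547 6125437])) (Cover 0 1257 135 [:: Emb 0 1654732 6541327; Emb 0 1623745
6523147; Emb 0 1654237 6541237; Emb 0 2361745 2561347; Emb 0 2316547 2365417; Emb 0 5416237
4165237]))) (Cover 0 127 13 [:: Emb 0 1654732 6541327; Emb 0 1654237 6541237; Emb 0 2316547
2365417])))) (Cover 3 47 3 [:: Emb 0 3271654 2136547; Emb 0 3216547 2165437])))))) (Split 2 3 (Split
1 2 (Emb 6 1374562 231456) (Split 4 2 (Emb 6 1734562 132456) (Split 3 4 (Emb 7 1723564 132456)
(Split 3 5 (Split 6 2 (Emb 7 4716352 316254) (Split 6 4 (Emb 7 2716534 316452) (Split 6 3 (Split 4 6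
(Emb 8 1453276 645231) (Split 2 6 (Emb 8 1235476 625431) (Split 2 5 (Cover 0 2467 135 [:: Emb 0
2371654 2316547; Emb 0 2354716 2543167; Emb 0 2345617 2345617; Emb 0 4523716 4523167; Emb 0 4523617
4523617; Emb 0 6123547 6125437]) (Cover 0 267 13 [:: Emb 0 2354716 2543167; Emb 0 2345617 2345617;
Emb 0 6123547 6125437])))) (Cover 7 16 1 [:: Emb 0 1654237 6541237; Emb 0 6123547 6125437]))))
(Split 3 6 (Split 1 4 (Emb 8 2745631 134562) (Split 1 5 (Emb 7 5632741 562134) (Split 6 2 (Emb 7
4713652 316254) (Cover 0 1367 136 [:: Emb 0 1654723 6541327; Emb 0 1327456 6213457; Emb 0 1236547
1265437; Emb 9 1745632 134576; Emb 0 3216547 2165437; Emb 0 6541327 5416237])))) (Cover 3 17 3 [::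
Emb 0 1654723 6541327; Emb 0 3216547 2165437])))))) (Cover 7 12 1 [:: Emb 0 1654237 6541237; Emb 0
2345617 2345617])))) (Cover 7 34 3 [:: Emb 0 3216547 2165437; Emb 0 4561237 4561237])))))));
(14%digits, Split 7 6 (Emb 9 6723451 612345) (Split 7 2 (Emb 9 3716542 216543) (Split 7 3 (Emb 9
3756124 345612) (Split 7 5 (Emb 9 6743215 543216) (Split 1 4 (Split 4 6 (Emb 7 2756431 145632)
(Split 4 5 (Emb 10 4617235 564123) (Split 1 3 (Split 4 2 (Emb 9 2416573 236541) (Split 4 1 (Emb 7
5723164 412365) (Split 5 3 (Split 2 4 (Emb 10 5327164 324165) (Split 3 4 (Emb 10 1234567 124356)
(Cover 7 23 1 [:: Emb 0 2345617 2345617; Emb 0 3216547 2165347]))) (Cover 4 57 4 [:: Emb 0 4327165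
3214657; Emb 0 4321657 3216547])))) (Split 1 2 (Split 4 1 (Emb 10 1347562 231456) (Split 3 1 (Emb 10
2345617 134562) (Cover 7 34 4 [:: Emb 0 3456127 3456217; Emb 0 4321657 3216547]))) (Cover 0 147 14
[:: Emb 0 1657234 6541237; Emb 0 1654327 6543217; Emb 0 4321657 3216547]))))) (Split 2 4 (Split 5 2
(Emb 7 1743562 143256) (Split 5 3 (Emb 10 7235614 423561) (Split 2 5 (Split 5 1 (Emb 7 4716235
416523) (Split 5 6 (Emb 7 2617435 561432) (Split 4 5 (Split 6 4 (Emb 10 5612347 461235) (Cover 5 16
5 [:: Emb 0 1643275 6532147; Emb 0 5234716 5234167])) (Cover 5 47 4 [:: Emb 0 4327165 3241657; Emb 0
5432617 4325617])))) (Split 2 6 (Split 5 1 (Emb 10 2657431 651432) (Split 6 1 (Emb 10 1654327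
154326) (Cover 7 56 4 [:: Emb 0 5612347 5612347; Emb 0 6543217 5432617]))) (Cover 0 257 14 [:: Emb 0
2347165 2341657; Emb 0 2345617 2345617; Emb 0 5612347 5612347]))))) (Cover 7 12 1 [:: Emb 0 1654327
6543217; Emb 0 2345617 2345617])))))));
(* Patterns 9, 10 and 11 are the pairs at cyclic distance 1, 2 and 3, so any two rows containing [x]
   are excluded. *)
(0%digits, Split 7 1 (Split 7 6 (Emb 9 6723451 612345) (Split 7 2 (Emb 9 3716542 216543) (Split 7 3
(Emb 10 1234567 123456) (Split 7 4 (Emb 11 1234567 123456) (Split 7 5 (Emb 10 2165437 165432) (Cover
7 12 1 [:: Emb 0 1654327 6543217; Emb 0 2345617 2345617])))))) (Split 7 2 (Split 7 3 (Emb 9 4721653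
321654) (Split 7 4 (Emb 10 2345617 234561) (Split 7 5 (Emb 11 2345617 234561) (Split 7 6 (Emb 10
3216547 216543) (Cover 7 23 2 [:: Emb 0 2165437 1654327; Emb 0 3456127 3456127]))))) (Split 7 3
(Split 7 4 (Emb 9 5732164 432165) (Split 7 5 (Emb 10 3456127 345612) (Split 7 6 (Emb 11 1654327
654321) (Cover 7 34 3 [:: Emb 0 3216547 2165437; Emb 0 4561237 4561237])))) (Split 7 4 (Split 7 5
(Emb 9 6743215 543216) (Split 7 6 (Emb 10 1654327 654321) (Cover 7 45 4 [:: Emb 0 4321657 3216547;
Emb 0 5612347 5612347]))) (Split 7 5 (Split 7 6 (Emb 9 1754326 654321) (Cover 7 56 5 [:: Emb 0
5432167 4321657; Emb 0 6123457 6123457])) (Split 7 6 (Cover 7 16 6 [:: Emb 0 1234567 1234567; Emb 0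
6543217 5432167]) (Cover 7 34 1 [:: Cover 7 24 7 [:: Emb 0 2165437 1654378; Emb 0 4561237 4561278];
Cover 7 35 7 [:: Emb 0 3216547 2165478; Emb 0 5612347 5612378]])))))))].

(** * Replaying the recorded trees *)

Lemma refutation3_check : check 3 [:: cycle_pattern 3 3 [::]] refutation3 [::].
Proof. by vm_compute. Qed.

Lemma refutations4_check :
  check_chain 4 [:: cycle_pattern 4 4 [::]] refutations4.
Proof. by vm_compute. Qed.

Lemma refutations5_check :
  check_chain 5 [:: cycle_pattern 5 5 [::]] refutations5.
Proof. by vm_compute. Qed.

Lemma refutations6_check :
  check_chain 6 [:: cycle_pattern 6 6 [::]] refutations6.
Proof. by vm_compute. Qed.

Lemma refutations7_check :
  check_chain 7 [:: cycle_pattern 7 7 [::]] refutations7.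
Proof. by vm_compute. Qed.

(** * The induction over subsets of [X] *)

Section Hamiltonian.

Variables (T : finType) (e : rel T) (X Y : {set T}).
Hypotheses (sym_e : symmetric e) (bipX : bipartition e X Y).
Hypothesis superX : super_neighborhood e X.

(** This starts the chain: with [hamiltonian] as the goal, a realization of the full cycle is
    already the goal. *)
Lemma refuted_hamiltonian (X' : {set T}) x0 :
  {in [:: cycle_pattern #|X'| #|X'| [::]],
    forall P, refuted e X' x0 (hamiltonian e X') P}.
Proof. by move=> P; rewrite inE => /eqP-> xs ys sM; exists x0, xs, ys. Qed.

Section Demands.

Variable X' : {set T}.
Hypotheses (subX : X' \subset X) (X'3 : 3 <= #|X'|).

Lemma pair_demand a b : a \in X' -> b \in X' -> a != b ->
  exists y, e y a && e y b.
Proof.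
(* [super_pair] needs a third vertex to complete the triple; it exists because [X'] has at least
   three elements. *)
move=> aX bX ab; have /card_gt0P[c] : 0 < #|X' :\: [set a; b]|.
  rewrite cardsD subn_gt0; apply: leq_ltn_trans X'3.
  by apply: leq_trans (subset_leq_card (subsetIr _ _)) _; rewrite cards2 ab.
rewrite !inE negb_or eq_sym [c == b]eq_sym => /andP[/andP[ac bc] cX].
by apply: (super_pair sym_e bipX superX (c := c)) => //; apply: (subsetP subX).
Qed.

Lemma cherry_demand a b c : a \in X' -> b \in X' -> c \in X' ->
  a != b -> a != c -> b != c -> 2 <= #|[set y | e y a && (e y b || e y c)]|.
Proof.
move=> aX bX cX ab ac bc.
by apply: (super_cherry sym_e bipX superX) => //; apply: (subsetP subX).
Qed.

Lemma clique_demand (S : {set T}) : S \subset X' -> 3 <= #|S| ->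
  #|S| <= #|Lambda e 2 S|.
Proof. by move=> SX S3; case: (superX (subset_trans SX subX) S3). Qed.

End Demands.

Lemma hamiltonian3 (X' : {set T}) :
  X' \subset X -> #|X'| = 3 -> hamiltonian e X'.
Proof.
move=> subX X'3; have X'ge3 : 3 <= #|X'| by rewrite X'3.
have /card_gt0P[x0 _] : 0 < #|X'| by rewrite X'3.
have := refutation3_check; rewrite -X'3 => chk.
apply: (check_sound (pair_demand subX X'ge3) (cherry_demand subX)
  (clique_demand subX) (@refuted_hamiltonian X' x0) chk (xs := enum X') (ys := [::])).
by split=> // [|x|y x b _]; rewrite ?enum_uniq ?mem_enum // /entry !nth_nil.
Qed.

(** Appending [x] as the last column turns the Berge cycle of [X' :\ x] into a realization of the
    pattern with empty [J], which leaves that column undetermined. The chain refutes this pattern,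
    and refuting it means producing the full cycle. *)
Lemma hamiltonian_step (X' : {set T}) ls : X' \subset X -> 4 <= #|X'| ->
  check_chain #|X'| [:: cycle_pattern #|X'| #|X'| [::]] ls ->
  [::] \in [seq digits l.1 | l <- ls] ->
  (forall x, x \in X' -> hamiltonian e (X' :\ x)) -> hamiltonian e X'.
Proof.
move=> subX X'4 chk nil_ls IH.
have /card_gt0P[x xX'] : 0 < #|X'| by apply: leq_trans X'4.
have [x0 [xs [ys sM]]] := IH x xX'.
apply: (check_chain_sound (pair_demand subX (ltnW X'4)) (cherry_demand subX)
  (clique_demand subX) (@refuted_hamiltonian X' x0) chk nil_ls
  (xs := rcons xs x) (ys := ys)).
have sz_xs := size_sat sM; have [Uxs Exs Uys sz_ys HM] := sM.
have cX' : #|X'| = #|X' :\ x|.+1 by rewrite (cardsD1 x X') xX'.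
rewrite cX' /=; rewrite size_cycle_pattern in sz_ys; split=> //.
- by rewrite rcons_uniq Exs !inE eqxx.
- by move=> z; rewrite mem_rcons inE Exs !inE; case: eqVneq => [->|].
- by rewrite size_cycle_pattern.
move=> i j b; rewrite cX' => lt_j; rewrite entry_cycle_pattern.
case: ifP => // /and3P[lt_i _ ij] [<-].
(* With [J] empty, every recorded incidence lies in a column of the smaller cycle, never in the
   column of [x]. *)
have {}ij : (j == i) || (j == i.+1 %% #|X' :\ x|).
  by move: ij; rewrite in_nil andbF orbF.
have lt_jx : j < #|X' :\ x|.
  by case/orP: ij => /eqP-> //; rewrite ltn_pmod // (leq_ltn_trans _ lt_i).
rewrite nth_rcons sz_xs lt_jx; apply: HM => //.
by rewrite entry_cycle_pattern lt_i lt_jx; case/orP: ij => ->; rewrite ?orbT.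
Qed.

(** The induction runs over subsets rather than over graphs, with [e] and [superX] fixed. Each
    certificate is computed for a numeral, so the cardinality must be identified as 4, 5, 6 or 7
    before the step applies. *)
Lemma super_hamiltonian (X' : {set T}) :
  X' \subset X -> 3 <= #|X'| <= 7 -> hamiltonian e X'.
Proof.
move: {2}#|X'| (erefl #|X'|) => n; elim: n X' => [|n IHn] X' cX'.
  by rewrite cX'.
move=> subX bnd; have [X'3|X'3] := eqVneq #|X'| 3; first exact: hamiltonian3.
have X'4 : 4 <= #|X'| by case/andP: bnd; rewrite leq_eqVlt eq_sym (negPf X'3).
have IH x : x \in X' -> hamiltonian e (X' :\ x).
  move=> xX'; have cD : #|X' :\ x| = n.
    by move: cX'; rewrite (cardsD1 x X') xX' => -[].
  apply: IHn => //; first by apply: subset_trans (subD1set _ _) subX.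
  rewrite cD; move: X'4 bnd; rewrite cX' ltnS => -> /andP[_ /ltnW].
  exact.
have [le6|gt6] := leqP #|X'| 6; last first.
  have c7 : #|X'| = 7 by apply/eqP; rewrite eqn_leq gt6 andbT; case/andP: bnd.
  by apply: hamiltonian_step subX X'4 _ _ IH; rewrite ?c7; [exact: refutations7_check|].
have [le5|gt5] := leqP #|X'| 5; last first.
  have c6 : #|X'| = 6 by apply/eqP; rewrite eqn_leq gt5 andbT.
  by apply: hamiltonian_step subX X'4 _ _ IH; rewrite ?c6; [exact: refutations6_check|].
have [le4|gt4] := leqP #|X'| 4; last first.
  have c5 : #|X'| = 5 by apply/eqP; rewrite eqn_leq gt4 andbT.
  by apply: hamiltonian_step subX X'4 _ _ IH; rewrite ?c5; [exact: refutations5_check|].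
have c4 : #|X'| = 4 by apply/eqP; rewrite eqn_leq le4.
by apply: hamiltonian_step subX X'4 _ _ IH; rewrite ?c4; [exact: refutations4_check|].
Qed.

End Hamiltonian.

Theorem theorem1p5 (T : finType) (e : rel T) (X Y : {set T})
    (hG : simple_graph e) (hXY : bipartition e X Y)
    (hX : 3 <= #|X| <= 7) (hS : super_neighborhood e X) :
  exists c : seq T, graph_cycle e c /\ {subset X <= c}.
Proof.
have [sym_e _] := hG; have /andP[X3 _] := hX.
have [x0 [xs [ys sM]]] := super_hamiltonian sym_e hXY hS (subxx X) hX.
exact: (sat_cycle sym_e hXY X3 sM).
Qed.
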